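(* Let $\varphi,\psi:[0,1]\to\mathbb R$ be continuously differentiable. Under the standing assumption and Assumption 2, with $h=h_n\to0$ and $nh_n\to\infty$, $$Z_n^T(u^* )=Z_n^{T*}(u^* )+R_n^T(u^* ),\qquad u^*\in[h,1-h],$$ where $Z_n^T(u^* )=\sqrt{nh}\,(\hat T_h(u^* )-T(u^* ))/\hat q_h(u^* )$, $Z_n^{T*}(u^* )=-\varphi(u^* )A(u^* )\mathbb G_{n,h}(u^* )$, and $\sup_{u^*\in[h,1-h]}|R_n^T(u^* )|=O_{a.s.}\big(n^{1/2}h^{3/2}+h^{1/2}+h^{-1/2}n^{-1/4}\ell(n)\big)$.
   Context: Standing assumption: $b_1,\dots,b_n$ i.i.d. bids with continuous CDF $F$, quantile function $Q=F^{-1}$ twice continuously differentiable on $[0,1]$, $q=Q'>0$ on $[0,1]$. $p_1,\dots,p_M$ fixed known nonnegative numbers, $A_1(u)=\sum_{m=1}^Mp_mu^{m-1}$ with $A_1'\ne0$ on $[0,1]$, $A=A_1/A_1'$. $v(u)=Q(u)+A(u)q(u)$. Counterfactual: $T(u^* )=\varphi(u^* )v(u^* )+\int_{u^*}^1\psi(x)v(x)\,dx$. Estimators: $b_{(i)}$ order statistics; $\hat Q(u)=b_{(\lfloor nu\rfloor+1)}$ ($u<1$), $\hat Q(1)=b_{(n)}$; $K_h(z)=h^{-1}K(z/h)$; $\hat q_h(u)=\sum_{i=1}^{n-1}K_h(u-i/n)(b_{(i+1)}-b_{(i)})$; $\hat v_h=\hat Q+A\hat q_h$; $\chi_\psi=(1-A')\psi-A\psi'$;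 $\hat S_\psi(u^* )=\int_{u^*}^1\chi_\psi(u)\hat Q(u)du-A(u^* )\psi(u^* )\hat Q(u^* )+A(1)\psi(1)\hat Q(1)$; $\hat T_h(u^* )=\varphi(u^* )\hat v_h(u^* )+\hat S_\psi(u^* )$. $\mathbb G_{n,h}(u)=\sqrt{nh}\,\frac1n\sum_{i=1}^n[K_h(u-F(b_i))-\mathbb EK_h(u-F(b_i))]$; $\ell(n)=(\log n)^{1/2}(\log\log n)^{1/4}$. Assumption 2: $K$ nonnegative, $\int K=1$, $\int K^2<\infty$, Lipschitz, supported on $[-1,1]$. $X_n=O_{a.s.}(r_n)$ means $|X_n|\le Cr_n$ for all large $n$ with $C$ an a.s. finite random variable. *)

(* Defs.v *)
From HB Require Import structures.
From mathcomp Require Import all_boot all_order all_algebra.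
From mathcomp Require Import all_classical all_reals all_analysis.
Set Implicit Arguments. Unset Strict Implicit. Unset Printing Implicit Defensive.
Import Order.TTheory GRing.Theory Num.Theory.
Import numFieldNormedType.Exports.
Local Open Scope classical_set_scope.
Local Open Scope ring_scope.

Section Defs.
Context {R : realType}.

Definition mutually_independent {d} {T : measurableType d}
    (P : probability T R) (X : nat -> T -> R) : Prop :=
  forall (s : seq nat) (B : nat -> set R), uniq s ->
    (forall i, measurable (B i)) ->
    P (\big[setI/setT]_(i <- s) (X i @^-1` B i)) =
    (\prod_(i <- s) fine (P (X i @^-1` B i)))%:E.

(** k-th smallest (0-based) among b_0(t), ..., b_{n-1}(t);
    i.e. ostat b n t k = b_{(k+1)} in the paper's 1-based notation *)
Definition ostat {T : Type} (b : nat -> T -> R) (n : nat) (t : T) (k : nat) : R :=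
  nth 0 (sort <=%R (mkseq (fun i => b i t) n)) k.

Definition Qhat {T : Type} (b : nat -> T -> R) (n : nat) (t : T) (u : R) : R :=
  if u < 1 then ostat b n t (Num.truncn (n%:R * u)) else ostat b n t n.-1.

Definition Kh (K : R -> R) (h z : R) : R := h^-1 * K (z / h).

Definition qhat {T : Type} (K : R -> R) (b : nat -> T -> R) (n : nat) (h : R)
    (t : T) (u : R) : R :=
  \sum_(1 <= i < n) Kh K h (u - i%:R / n%:R) * (ostat b n t i - ostat b n t i.-1).

Definition A1poly (M : nat) (p : nat -> R) : {poly R} :=
  \sum_(1 <= m < M.+1) (p m)%:P * 'X^(m.-1).

Definition A1 (M : nat) (p : nat -> R) (u : R) : R := (A1poly M p).[u].
Definition A1' (M : nat) (p : nat -> R) (u : R) : R := (deriv (A1poly M p)).[u].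

Definition Afun (M : nat) (p : nat -> R) (u : R) : R := A1 M p u / A1' M p u.

Definition vfun (M : nat) (p : nat -> R) (Q q : R -> R) (u : R) : R :=
  Q u + Afun M p u * q u.

Definition Tcf (M : nat) (p : nat -> R) (Q q phi psi : R -> R) (us : R) : R :=
  phi us * vfun M p Q q us +
  \int[lebesgue_measure]_(x in `[us, 1]) (psi x * vfun M p Q q x).

(** chi_psi = (1 - A') psi - A psi'  (dpsi is the derivative of psi) *)
Definition chi (M : nat) (p : nat -> R) (psi dpsi : R -> R) (u : R) : R :=
  (1 - derive1 (Afun M p) u) * psi u - Afun M p u * dpsi u.

Definition vhat {T : Type} (M : nat) (p : nat -> R) (K : R -> R)
    (b : nat -> T -> R) (n : nat) (h : R) (t : T) (u : R) : R :=
  Qhat b n t u + Afun M p u * qhat K b n h t u.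

Definition Shat {T : Type} (M : nat) (p : nat -> R) (psi dpsi : R -> R)
    (b : nat -> T -> R) (n : nat) (t : T) (us : R) : R :=
  \int[lebesgue_measure]_(u in `[us, 1]) (chi M p psi dpsi u * Qhat b n t u)
  - Afun M p us * psi us * Qhat b n t us + Afun M p 1 * psi 1 * Qhat b n t 1.

Definition That {T : Type} (M : nat) (p : nat -> R) (K : R -> R)
    (phi psi dpsi : R -> R) (b : nat -> T -> R) (n : nat) (h : R) (t : T)
    (us : R) : R :=
  phi us * vhat M p K b n h t us + Shat M p psi dpsi b n t us.

Definition Gnh {d} {T : measurableType d} (P : probability T R)
    (K F : R -> R) (b : nat -> T -> R) (n : nat) (h : R) (t : T) (u : R) : R :=
  Num.sqrt (n%:R * h) * (n%:R^-1 *
    \sum_(i < n) (Kh K h (u - F (b i t))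
                  - \int[P]_(w in setT) Kh K h (u - F (b i w)))).

Definition ell (n : nat) : R :=
  Num.sqrt (ln (n%:R : R)) * powR (ln (ln (n%:R : R))) (4%:R^-1).

Definition rate (n : nat) (h : R) : R :=
  powR (n%:R) (2%:R^-1) * powR h (3%:R / 2%:R) + powR h (2%:R^-1)
  + powR h (- 2%:R^-1) * powR (n%:R) (- 4%:R^-1) * ell n.

End Defs.

(* Main.v *)
(** With [U_i = F(b_i)] uniform, [qhat u / q u] is, up to a relative error
    [O(h + sup|U_(i) - i/n|)], the kernel-weighted sum of spacings
    [W = sum_i K_h(u - i/n) (U_(i+1) - U_(i))], while [1 + G_{n,h}(u) / sqrt(nh)] is the kernel
    density estimate [E = (1/n) sum_i K_h(u - U_i)]. Summation by parts against the Lipschitz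
    kernel turns [W + E - 2] into an average of the Bahadur-Kiefer sums
    [(U_(j) - j/n) + (F_n(j/n) - j/n)], hence [W + E - 2 = O(h^-1 n^(-3/4) ell(n))]; as
    [E W - 1 = E (W + E - 2) - (E - 1)^2], the ratio [1/W], that is [q/qhat], is [E] up to the
    stated rate. What remains of [That - T] is linear in [Qhat - Q] after an integration by parts.

    The Bahadur-Kiefer bound rests on the law of the iterated logarithm for the empirical process
    (dyadic chaining in time and space at once, so that no maximal inequality is needed) and on
    its modulus of continuity. When [h^-1 n^(-3/4) ell(n)] is not small, [W] need not be close to
    1: it is then enough to bound [W] from below, by the modulus of continuity when [nh] is of
    order [log n] or more, and otherwise because no interval of length about [n^(-9/8)] contains
    32 sample points. *)
Require Import Defs.
From HB Require Import structures.
From mathcomp Require Import all_boot all_order all_algebra.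
From mathcomp Require Import all_classical all_reals all_analysis.
From mathcomp Require Import measurable_realfun ring lra.
Set Implicit Arguments.
Unset Strict Implicit.
Unset Printing Implicit Defensive.
Import Order.TTheory GRing.Theory Num.Theory.
Import numFieldNormedType.Exports.
Local Open Scope classical_set_scope.
Local Open Scope ring_scope.

Section Preliminaries.
Context {R : realType}.

Lemma sumr_inv_sqr_le2 n : \sum_(0 <= i < n) (i.+1%:R ^+ 2)^-1 <= 2 :> R.
Proof.
pose f i : R := - (2 / i.+1%:R).
apply: (@le_trans _ _ (\sum_(0 <= i < n) (f i.+1 - f i))); last first.
  by rewrite telescope_sumr// /f divr1 opprK gerDr oppr_le0 divr_ge0.
apply: ler_sum => i _; rewrite /f -[i.+2%:R]natr1 -subr_ge0.
have : 1 <= i.+1%:R :> R by rewrite ler1n.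
move: (i.+1%:R) => x x1.
have -> : - (2 / (x + 1)) - - (2 / x) - (x ^+ 2)^-1 = (x - 1) / (x ^+ 2 * (x + 1)).
  by field; rewrite !gt_eqF//; lra.
by rewrite divr_ge0 ?mulr_ge0 ?sqr_ge0//; lra.
Qed.

Lemma expR_le_quadratic (x : R) : `|x| <= 1 -> expR x <= 1 + x + 2 * x ^+ 2.
Proof.
move=> x1; have /andP[xN1 x1'] : -1 <= x <= 1 by rewrite -ler_norml.
have tangent : 1 - x / 2 <= expR (- (x / 2)) by exact: expR_ge1Dx.
have -> : expR x = (expR (- (x / 2)) ^+ 2)^-1.
  by rewrite -expRM_natl -expRN; congr expR; field.
have e0 : 0 < expR (- (x / 2)) by exact: expR_gt0.
rewrite -[leLHS]mul1r ler_pdivrMr ?exprn_gt0//.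
have sqr_tangent : (1 - x / 2) ^+ 2 <= expR (- (x / 2)) ^+ 2.
  by rewrite ler_sqr ?nnegrE ?expR_ge0//; lra.
apply: le_trans (ler_wpM2l _ sqr_tangent); last by nra.
rewrite [leRHS](_ : _ = 1 + x ^+ 2 * (1 - x) * (5 / 4 - x / 2)); last by field.
by rewrite lerDl; apply: mulr_ge0; [apply: mulr_ge0; [exact: sqr_ge0|lra]|lra].
Qed.

Lemma expR1_le4 : expR 1 <= 4 :> R.
Proof. by apply: le_trans (expR_le_quadratic _) _; rewrite ?normr1//; lra. Qed.

Lemma bernoulli_ineq (x : R) n : 0 <= x -> 1 + n%:R * x <= (1 + x) ^+ n.
Proof.
move=> x0; elim: n => [|n IH]; first by rewrite mul0r addr0.
have : 0 <= n%:R * x by rewrite mulr_ge0.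
by rewrite exprS -natr1; move: IH; move: (_ ^+ n) (n%:R) => y m; nra.
Qed.

Lemma natr_div_itv01 j n : (j <= n)%N -> 0 <= (j%:R / n%:R : R) <= 1.
Proof.
case: n => [|n] jn; first by rewrite invr0 mulr0 lexx ler01.
by rewrite divr_ge0//= ler_pdivrMr ?ltr0n// mul1r ler_nat.
Qed.

Lemma ler_natr_div (i j n : nat) : (i <= j)%N -> i%:R / n%:R <= j%:R / n%:R :> R.
Proof. by move=> ij; rewrite ler_wpM2r ?invr_ge0// ler_nat. Qed.

Lemma natrS_div_sub (j n : nat) : j.+1%:R / n%:R - j%:R / n%:R = n%:R^-1 :> R.
Proof. by rewrite -mulrBl -natr1 addrAC subrr add0r mul1r. Qed.

End Preliminaries.

Section ProbabilityBounds.
Context {d} {T : measurableType d} {R : realType} (P : probability T R).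
Implicit Types (A : (set T)^nat) (e : R).

Lemma probability_bigcup_le n A e : (forall i, (i < n)%N -> measurable (A i)) ->
  (forall i, (i < n)%N -> (P (A i) <= e%:E)%E) ->
  (P (\bigcup_(i < n) A i) <= (n%:R * e)%:E)%E.
Proof.
move=> mA PA; rewrite bigcup_mkord; apply: le_trans (Boole_inequality P mA) _.
apply: le_trans (lee_sum _ (fun i _ => PA _ (ltn_ord i))) _.
by rewrite sumEFin sumr_const card_ord mulr_natl.
Qed.

Lemma borel_cantelli_inv_sqr A (C : R) : (forall n, measurable (A n)) ->
  (\forall n \near \oo, (P (A n) <= (C / n%:R ^+ 2)%:E)%E) ->
  {ae P, forall t, \forall n \near \oo, ~ A n t}.
Proof.
move=> mA [N _ PA]; pose B n := A (n + N).+1.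
have PB n : (P (B n) <= (`|C| * (n.+1%:R ^+ 2)^-1)%:E)%E.
  apply: le_trans (PA _ _) _; first by rewrite /= leqW// leq_addl.
  rewrite lee_fin; apply: (@le_trans _ _ (`|C| / (n + N).+1%:R ^+ 2)).
    by rewrite ler_wpM2r ?invr_ge0 ?exprn_ge0// ler_norm.
  rewrite ler_wpM2l// lef_pV2 ?posrE ?exprn_gt0//.
  by rewrite lerXn2r ?nnegrE// ler_nat ltnS leq_addr.
exists (lim_sup_set B); split.
- by apply: bigcap_measurable => // k _; apply: bigcup_measurable => j _; exact: mA.
- apply: lim_sup_set_cvg0 => [n|]; first exact: mA.
  apply: (@le_lt_trans _ _ (`|C| * 2)%:E); last exact: ltry.
  apply: lime_le; first exact: is_cvg_nneseries.
  apply: nearW => n; apply: le_trans (lee_sum _ (fun i _ => PB i)) _.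
  by rewrite sumEFin lee_fin -mulr_sumr ler_wpM2l// sumr_inv_sqr_le2.
- move=> t /= io k _; apply: contrapT => nB; apply: io.
  exists (k + N.+1)%N => // n /= kn At; apply: nB; exists (n - N.+1)%N => /=.
    by rewrite -(addnK N.+1 k) leq_sub2r.
  by rewrite /B -addnS subnK// (leq_trans _ kn)// leq_addl.
Qed.

Lemma measurable_norm_ge (f : T -> R) (z : R) : measurable_fun setT f ->
  measurable [set t | z <= `|f t|].
Proof.
move=> mf; rewrite (_ : [set t | _] = (Num.norm \o f) @^-1` `[z, +oo[).
  by rewrite -[X in measurable X]setTI; apply: measurableT_comp.
by apply/seteqP; split => t /=; rewrite in_itv/= andbT.
Qed.

End ProbabilityBounds.

(** * Concentration of independent hits *)

Section IndependentHits.
Context {d} {T : measurableType d} {R : realType} (P : probability T R).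
Variables (X : nat -> T -> R) (B : set R) (p : R).
Hypothesis mX : forall i, measurable_fun setT (X i).
Hypothesis indepX : mutually_independent P X.
Hypothesis mB : measurable B.
Hypothesis PB : forall i, P (X i @^-1` B) = p%:E.

Definition hits (s : seq nat) (t : T) : R := \sum_(i <- s) \1_B (X i t).

Let hit i t : R := \1_B (X i t).

Let hit01 i t : 0 <= hit i t <= 1.
Proof. by rewrite /hit indicE; case: (_ \in _); rewrite ?lexx ?ler01. Qed.

Let m_hit i : measurable_fun setT (hit i).
Proof. by apply: measurableT_comp => //; exact: measurable_indic. Qed.

Lemma measurable_hits s : measurable_fun setT (hits s).
Proof. by apply: measurable_sum => i; exact: m_hit. Qed.

Lemma hit_probability01 : 0 <= p <= 1.
Proof.
rewrite -!lee_fin -(PB 0) measure_ge0 probability_le1//.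
by rewrite -[X in measurable X]setTI; exact: mX.
Qed.

Let weighted_hits c (r s : seq nat) t : R :=
  \prod_(i <- r) hit i t * \prod_(i <- s) (1 + c * hit i t).

Let integrable_weighted_hits c r s :
  P.-integrable setT (EFin \o weighted_hits c r s).
Proof.
apply: measurable_bounded_integrable => //.
- by rewrite (le_lt_trans (probability_le1 P measurableT))// ltry.
- apply: measurable_funM; first by apply: measurable_prod => i _; exact: m_hit.
  apply: measurable_prod => i _; apply: measurable_funD => //.
  by apply: measurable_funM => //; exact: m_hit.
exists ((1 + `|c|) ^+ size s); split; first exact: num_real.
move=> x xM t _ /=; apply: ltW; apply: le_lt_trans xM.
rewrite normrM !normr_prod -[leRHS]mul1r ler_pM ?prodr_ge0//.
  elim: r => [|i r IH]; first by rewrite big_nil.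
  rewrite big_cons -[leRHS]mul1r ler_pM ?prodr_ge0//.
  by have /andP[? ?] := hit01 i t; rewrite ger0_norm.
elim: s => [|i s IH]; first by rewrite big_nil expr0.
rewrite big_cons exprS ler_pM ?prodr_ge0//.
apply: le_trans (ler_normD _ _) _; rewrite normr1 lerD2l normrM.
by have /andP[? ?] := hit01 i t; rewrite [`|hit i t|]ger0_norm// ler_piMr.
Qed.

Let expectation_all_hit r : uniq r -> \int[P]_t (\prod_(i <- r) hit i t) = p ^+ size r.
Proof.
move=> ur.
have -> : (fun t => \prod_(i <- r) hit i t) =
    \1_(\big[setI/setT]_(i <- r) (X i @^-1` B)) :> (T -> R).
  apply/funext => t; elim: r {ur} => [|i r IH]; first by rewrite !big_nil indicT.
  by rewrite !big_cons IH indicI.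
rewrite /Rintegral integral_indic//; last first.
  by apply: bigsetI_measurable => i _; rewrite -[X in measurable X]setTI; exact: mX.
rewrite setIT; apply: etrans (congr1 fine (indepX (B := fun=> B) ur (fun=> mB))) _ => /=.
by under eq_bigr do rewrite PB /=; rewrite big_const_seq count_predT iter_mulr_1.
Qed.

(* Peeling off one factor [1 + c 1_i] moves the index [i] from [s] to [r]. *)
Let expectation_weighted_hits c r s : uniq (r ++ s) ->
  \int[P]_t weighted_hits c r s t = p ^+ size r * (1 + c * p) ^+ size s.
Proof.
elim: s r => [|j s IH] r urs.
  rewrite cats0 in urs; rewrite expr0 mulr1 -expectation_all_hit//.
  by apply: eq_Rintegral => t _; rewrite /weighted_hits big_nil mulr1.
have ujrs : uniq ((j :: r) ++ s) by move: urs; rewrite -cat1s uniq_catCA.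
have -> : weighted_hits c r (j :: s) =
    (fun t => weighted_hits c r s t + c * weighted_hits c (j :: r) s t).
  by apply/funext => t; rewrite /weighted_hits !big_cons; ring.
have int_peeled := integrableZl measurableT c (integrable_weighted_hits c (j :: r) s).
rewrite RintegralD// RintegralZl// !IH//; first by rewrite !exprS; ring.
by move: ujrs => /= /andP[].
Qed.

Lemma mgf_hits (lam : R) s : uniq s ->
  'M_P (hits s) lam = ((1 + (expR lam - 1) * p) ^+ size s)%:E.
Proof.
move=> us; have int := integrable_weighted_hits (expR lam - 1) [::] s.
have := @expectation_weighted_hits (expR lam - 1) [::] s us; rewrite expr0 mul1r => <-.
rewrite /mmt_gen_fun unlock /Rintegral fineK ?integrable_fin_num//.
apply: eq_integral => t _ /=; rewrite /weighted_hits big_nil mul1r; congr EFin.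
rewrite /hits; elim: s {us int} => [|i s IH]; first by rewrite !big_nil mul0r expR0.
rewrite !big_cons mulrDl expRD IH /hit indicE; congr (_ * _).
by case: (_ \in _); rewrite ?(mul1r, mul0r, mulr1, mulr0) ?expR0; ring.
Qed.

Lemma hits_chernoff (lam y : R) s : uniq s ->
  (P [set t | (y <= lam * hits s t)%R] <=
    (expR ((size s)%:R * p * (expR lam - 1) - y))%:E)%E.
Proof.
move=> us.
have mZ := measurable_funM (measurable_cst lam) (measurable_hits s).
pose Z : {RV P >-> R} := mfun_Sub (mem_set mZ).
have := chernoff Z y ltr01; rewrite mul1r.
have -> : 'M_P Z 1 = 'M_P (hits s) lam.
  by rewrite /mmt_gen_fun; congr expectation; apply/funext => t /=; rewrite mulr1 mulrC.
rewrite mgf_hits// => /le_trans; apply.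
rewrite -EFinM lee_fin expRD ler_wpM2r ?expR_ge0// -mulrA expRM_natl.
have /andP[p0 p1] := hit_probability01.
apply: lerXn2r; rewrite ?nnegrE ?expR_ge0//; first by have := expR_ge0 lam; nra.
by apply: le_trans (expR_ge1Dx _); rewrite mulrC.
Qed.

Let centered_tail (lam z V : R) s : uniq s -> `|lam| <= 1 -> (size s)%:R * p <= V ->
  (P [set t | (z <= lam * (hits s t - (size s)%:R * p))%R] <=
    (expR (2 * V * lam ^+ 2 - z))%:E)%E.
Proof.
move=> us lam1 sV; set Np := _ * p in sV *.
rewrite (_ : [set t | _] = [set t | z + lam * Np <= lam * hits s t]); last first.
  by apply/seteqP; split => t /=; rewrite mulrBr lerBrDr.
apply: le_trans (hits_chernoff _ _ us) _; rewrite lee_fin ler_expR -/Np.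
have Np0 : 0 <= Np by rewrite mulr_ge0//; case/andP: hit_probability01.
by have := expR_le_quadratic lam1; have := sqr_ge0 lam; nra.
Qed.

Lemma hits_bernstein (z V : R) s : uniq s -> (size s)%:R * p <= V -> 0 < V -> 0 <= z <= 4 * V ->
  (P [set t | (z <= `|hits s t - (size s)%:R * p|)%R] <=
    (2 * expR (- (z ^+ 2 / (8 * V))))%:E)%E.
Proof.
move=> us sV V0 /andP[z0 zV].
pose lam := z / (4 * V); pose dev t := hits s t - (size s)%:R * p.
have lam0 : 0 <= lam by rewrite divr_ge0// mulr_ge0// ltW.
have lam1 : `|lam| <= 1 by rewrite ger0_norm// ler_pdivrMr ?mul1r// mulr_gt0.
have expE : 2 * V * lam ^+ 2 - lam * z = - (z ^+ 2 / (8 * V)).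
  by rewrite /lam; field; rewrite gt_eqF.
have upper := centered_tail (lam * z) us lam1 sV.
have := centered_tail (lam := - lam) (lam * z) us _ sV.
rewrite normrN => /(_ lam1) lower; rewrite sqrrN expE in lower; rewrite expE in upper.
have m_dev c : measurable [set t | lam * z <= c * dev t].
  rewrite -[X in measurable X]setTI; apply: measurable_fun_le => //.
  by apply: measurable_funM => //; apply: measurable_funB => //; exact: measurable_hits.
rewrite [2 * expR _]mulr_natl mulr2n EFinD; apply: le_trans (leeD upper lower).
apply: le_trans (measureU2 P (m_dev lam) (m_dev (- lam))).
apply: le_measure; rewrite ?inE.
- by apply: measurable_norm_ge; apply: measurable_funB => //; exact: measurable_hits.
- exact: measurableU.
move=> t /=; rewrite ler_normr => /orP[zdev|zdev]; [left; exact: ler_wpM2l|right].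
by rewrite mulNr -mulrN; exact: ler_wpM2l.
Qed.

End IndependentHits.

Section CountDeviation.
Context {R : realType}.
Implicit Types (x : nat -> R) (u v : R).

Definition count_le x m n u : R := \sum_(m <= i < n) (x i <= u)%R%:R.

Definition count_dev x m n u : R := count_le x m n u - (n - m)%N%:R * u.

Lemma count_le_sub x m n u v : u <= v ->
  count_le x m n v - count_le x m n u = \sum_(m <= i < n) (u < x i <= v)%R%:R.
Proof.
move=> uv; rewrite -sumrB; apply: eq_bigr => i _.
have [xu|xu] := leP (x i) u; last by rewrite subr0.
by rewrite (le_trans xu uv) subrr.
Qed.

Lemma count_dev_cat x m n k u : (m <= n)%N -> (n <= k)%N ->
  count_dev x m k u = count_dev x m n u + count_dev x n k u.
Proof.
move=> mn nk; rewrite /count_dev /count_le (big_cat_nat mn nk)/=.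
by rewrite !natrB ?(leq_trans mn)//; ring.
Qed.

Lemma count_le_bounds x m n u : 0 <= count_le x m n u <= (n - m)%N%:R.
Proof.
rewrite sumr_ge0//= -sumr_const_nat; apply: ler_sum => i _.
by case: (x i <= u).
Qed.

Lemma count_dev_le x m n u : 0 <= u <= 1 -> `|count_dev x m n u| <= (n - m)%N%:R.
Proof.
move=> /andP[u0 u1]; have /andP[c0 c1] := count_le_bounds x m n u.
have : (n - m)%N%:R * u <= (n - m)%N%:R by rewrite ler_piMr.
have : 0 <= (n - m)%N%:R * u by rewrite mulr_ge0.
by rewrite ler_norml /count_dev => *; apply/andP; split; lra.
Qed.

Lemma count_dev_drift x m n u v : u <= v ->
  count_dev x m n u - (n - m)%N%:R * (v - u) <= count_dev x m n v.
Proof.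
move=> uv; have : 0 <= count_le x m n v - count_le x m n u.
  by rewrite count_le_sub// sumr_ge0.
by rewrite /count_dev mulrBr; lra.
Qed.

End CountDeviation.

Section UniformSample.
Context {d} {T : measurableType d} {R : realType} (P : probability T R).
Variable U : nat -> T -> R.

Definition uniform_sample : Prop := [/\ forall i, measurable_fun setT (U i),
  mutually_independent P U &
  forall i u, 0 <= u <= 1 -> P (U i @^-1` `]-oo, u]) = u%:E].

Hypothesis unifU : uniform_sample.

Let mU i : measurable_fun setT (U i). Proof. by case: unifU. Qed.

Lemma uniform_probability_itv (u v : R) i : 0 <= u -> u <= v -> v <= 1 ->
  P (U i @^-1` `]u, v]) = (v - u)%:E.
Proof.
move=> u0 uv v1; have [_ _ cdfU] := unifU.
have m x : measurable (U i @^-1` `]-oo, x]) by rewrite -[X in measurable X]setTI; exact: mU.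
have -> : U i @^-1` `]u, v] = U i @^-1` `]-oo, v] `\` U i @^-1` `]-oo, u].
  apply/seteqP; split => t /=; rewrite !in_itv/= ltNge.
    by move=> /andP[/negP ? ?].
  by move=> [? /negP ->].
have lt_oo : (P (U i @^-1` `]-oo, v]) < +oo)%E.
  by apply: le_lt_trans (probability_le1 P (m v)) _; rewrite ltry.
apply: etrans (measureD (m v) (m u) lt_oo) _.
rewrite setIidr; last by move=> t /=; rewrite !in_itv/= => /le_trans; exact.
by rewrite EFinB; congr (_ - _)%E; apply: cdfU; lra.
Qed.

Lemma measurable_count_le m n u : measurable_fun setT (fun t => count_le (U^~ t) m n u).
Proof.
apply: measurable_sum => i; rewrite (_ : (fun t => _) = \1_`]-oo, u] \o U i); last first.
  by apply/funext => t; rewrite /= indicE mem_setE in_itv.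
by apply: measurableT_comp => //; exact: measurable_indic.
Qed.

Lemma measurable_count_dev m n u : measurable_fun setT (fun t => count_dev (U^~ t) m n u).
Proof. by apply: measurable_funB => //; exact: measurable_count_le. Qed.

Lemma count_dev_bernstein m n (u z V : R) : 0 <= u <= 1 -> (n - m)%N%:R * u <= V -> 0 < V ->
  0 <= z <= 4 * V ->
  (P [set t | (z <= `|count_dev (U^~ t) m n u|)%R] <= (2 * expR (- (z ^+ 2 / (8 * V))))%:E)%E.
Proof.
move=> u01 nuV V0 hz; have [_ indepU cdfU] := unifU.
have := hits_bernstein mU indepU (measurable_itv `]-oo, u]) (fun i => cdfU i u u01)
  (iota_uniq m (n - m)) _ V0 hz.
rewrite size_iota => /(_ nuV); congr (P _ <= _)%E; apply/funext => t.
by rewrite /= /hits; under eq_bigr do rewrite indicE mem_setE in_itv/=.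
Qed.

Lemma count_dev_sub_bernstein m n (u v z V : R) : 0 <= u -> u <= v -> v <= 1 ->
  (n - m)%N%:R * (v - u) <= V -> 0 < V -> 0 <= z <= 4 * V ->
  (P [set t | (z <= `|count_dev (U^~ t) m n v - count_dev (U^~ t) m n u|)%R] <=
    (2 * expR (- (z ^+ 2 / (8 * V))))%:E)%E.
Proof.
move=> u0 uv v1 nuV V0 hz; have [_ indepU _] := unifU.
have := hits_bernstein mU indepU (measurable_itv `]u, v])
  (fun i => uniform_probability_itv i u0 uv v1) (iota_uniq m (n - m)) _ V0 hz.
rewrite size_iota => /(_ nuV); congr (P _ <= _)%E; apply/funext => t.
rewrite /= /hits; under eq_bigr do rewrite indicE mem_setE in_itv/=.
rewrite (_ : count_dev _ _ _ v - _ = count_le (U^~ t) m n v - count_le (U^~ t) m n u -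
  (n - m)%N%:R * (v - u)); last by rewrite /count_dev; ring.
by rewrite count_le_sub.
Qed.

End UniformSample.

(** * Oscillation and iterated logarithm of the empirical process *)

Section EighthRoot.
Context {R : realType}.

Definition root8 n : R := n%:R `^ 8%:R^-1.

Lemma root8_ge0 n : 0 <= root8 n.
Proof. exact: powR_ge0. Qed.

Lemma root8X8 n : root8 n ^+ 8 = n%:R.
Proof. by rewrite -powR_mulrn ?root8_ge0// -powRrM mulVf// powRr1. Qed.

Lemma root8_ge1 n : (0 < n)%N -> 1 <= root8 n.
Proof.
by move=> n0; rewrite -(@ler_pXn2r _ 8)// ?nnegrE ?root8_ge0// root8X8 expr1n ler1n.
Qed.

Lemma root8_le n : (0 < n)%N -> root8 n <= n%:R.
Proof. by move=> n0; rewrite -[in leRHS]root8X8 ler_eXnr// root8_ge1. Qed.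

End EighthRoot.

Section OscillationBound.
Context {R : realType}.
Implicit Types lam x y : R.

Definition osc_bound (lam x : R) : R := Num.sqrt (32 * (x + 2 * lam) * lam).

Lemma osc_bound_ge0 lam x : 0 <= osc_bound lam x.
Proof. exact: sqrtr_ge0. Qed.

Lemma osc_bound_sqr lam x : 0 <= lam -> 0 <= x ->
  osc_bound lam x ^+ 2 = 32 * (x + 2 * lam) * lam.
Proof. by move=> l0 x0; rewrite sqr_sqrtr// !mulr_ge0// addr_ge0// mulr_ge0. Qed.

Lemma osc_bound_homo lam : 0 <= lam -> {homo osc_bound lam : x y / x <= y}.
Proof.
by move=> l0 x y xy; apply: ler_wsqrtr; rewrite ler_wpM2r// ler_wpM2l// lerD2r.
Qed.

Lemma osc_bound_le_affine lam x : 0 <= lam -> 0 <= x -> osc_bound lam x <= x + 10 * lam.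
Proof.
move=> l0 x0; rewrite -(@ler_pXn2r _ 2)// ?nnegrE ?osc_bound_ge0 ?addr_ge0 ?mulr_ge0//.
rewrite osc_bound_sqr// -subr_ge0 (_ : _ - _ = (x - 6 * lam) ^+ 2) ?sqr_ge0//; ring.
Qed.

End OscillationBound.

Section AlmostSureModulus.
Context {d} {T : measurableType d} {R : realType} (P : probability T R).
Variable U : nat -> T -> R.
Hypothesis unifU : uniform_sample P U.

Definition oscillating n i j (t : T) : Prop :=
  osc_bound (ln n%:R) (j%:R - i%:R) <=
  `|count_dev (U^~ t) 0 n (j%:R / n%:R) - count_dev (U^~ t) 0 n (i%:R / n%:R)|.

Let measurable_oscillating n i j : measurable (oscillating n i j).
Proof.
apply: measurable_norm_ge; apply: measurable_funB; exact: (measurable_count_dev unifU).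
Qed.

Lemma prob_oscillating n i j : (1 < n)%N -> (i <= j <= n)%N ->
  (P (oscillating n i j) <= (2 / n%:R ^+ 4)%:E)%E.
Proof.
move=> n1 /andP[ij jn]; set l : R := ln n%:R.
have n0 : 0 < n%:R :> R by rewrite ltr0n ltnW.
have l0 : 0 < l by rewrite ln_gt0// ltr1n.
have ij0 : 0 <= j%:R - i%:R :> R by rewrite subr_ge0 ler_nat.
have /andP[i0 _] := natr_div_itv01 (R := R) (leq_trans ij jn).
have /andP[_ j1] := natr_div_itv01 (R := R) jn.
pose V : R := j%:R - i%:R + 2 * l; pose z : R := osc_bound l (j%:R - i%:R).
have V0 : 0 < V by rewrite /V; lra.
have z2 : z ^+ 2 = 32 * V * l by rewrite osc_bound_sqr// ltW.
have -> : 2 / n%:R ^+ 4 = 2 * expR (- (z ^+ 2 / (8 * V))).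
  rewrite z2 (_ : 32 * V * l / (8 * V) = 4%:R * l); last by field; rewrite gt_eqF.
  by rewrite expRN expRM_natl lnK ?posrE.
apply: (count_dev_sub_bernstein unifU i0 (ler_natr_div n ij) j1) => //.
- rewrite subn0 -mulrBl mulrCA divff ?gt_eqF// mulr1 /V; lra.
- rewrite osc_bound_ge0 /= -(@ler_pXn2r _ 2)// ?nnegrE ?osc_bound_ge0 ?mulr_ge0 ?(ltW V0)// z2.
  have : 2 * l <= V by rewrite /V; lra.
  by nra.
Qed.

Lemma ae_oscillation : {ae P, forall t, \forall n \near \oo, forall i j, (i <= j <= n)%N ->
  `|count_dev (U^~ t) 0 n (j%:R / n%:R) - count_dev (U^~ t) 0 n (i%:R / n%:R)| <=
    osc_bound (ln n%:R) (j%:R - i%:R)}.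
Proof.
pose A n i j := if (i <= j <= n)%N then oscillating n i j else set0.
have mA n i j : measurable (A n i j) by rewrite /A; case: ifP.
have mAn n i : measurable (\bigcup_(j < n.+1) A n i j) by apply: fin_bigcup_measurable.
suff: {ae P, forall t, \forall n \near \oo, ~ (\bigcup_(i < n.+1) \bigcup_(j < n.+1) A n i j) t}.
  apply: filterS => t; apply: filterS => n nA i j ijn.
  rewrite leNgt; apply/negP => /ltW osc_ij; apply: nA; have /andP[ij jn] := ijn.
  by exists i; [rewrite /= ltnS (leq_trans ij)|exists j; [rewrite /= ltnS|rewrite /A ijn]].
apply: (@borel_cantelli_inv_sqr _ _ _ _ _ 8).
  by move=> n; apply: fin_bigcup_measurable.
exists 2 => // n /= n1; have n1R : 1 <= n%:R :> R by rewrite ler1n ltnW.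
apply: (@le_trans _ _ (n.+1%:R * (n.+1%:R * (2 / n%:R ^+ 4)))%:E).
  do 2 apply: probability_bigcup_le => // ? _.
  by rewrite /A; case: ifPn => [|_]; [exact: prob_oscillating|rewrite measure0 lee_fin divr_ge0].
rewrite lee_fin -natr1 -subr_ge0.
have -> : 8 / n%:R ^+ 2 - (n%:R + 1) * ((n%:R + 1) * (2 / n%:R ^+ 4)) =
  (8 * n%:R ^+ 2 - 2 * (n%:R + 1) ^+ 2) / n%:R ^+ 4 :> R by field; rewrite gt_eqF//; lra.
by rewrite divr_ge0 ?exprn_ge0//; nra.
Qed.

End AlmostSureModulus.

Definition num_cells (R : realType) n : nat := (n * (Num.truncn (root8 n : R)).+1)%N.

Definition cell_count {R : realType} (x : nat -> R) n i : R :=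
  count_le x 0 n (i.+1%:R / (num_cells R n)%:R) - count_le x 0 n (i%:R / (num_cells R n)%:R).

Section CrowdedCells.
Context {d} {T : measurableType d} {R : realType} (P : probability T R).
Variable U : nat -> T -> R.
Hypothesis unifU : uniform_sample P U.

Lemma num_cells_bounds n : (0 < n)%N ->
  (n%:R * root8 n : R) <= (num_cells R n)%:R <= 2 * (n%:R * root8 n : R).
Proof.
move=> n0; have nR : 0 < n%:R :> R by rewrite ltr0n.
have /andP[lo hi] := truncn_itv (root8_ge0 (R := R) n).
have r1 : 1 <= root8 n :> R by rewrite root8_ge1.
by rewrite natrM mulrCA !ler_pM2l//; rewrite -natr1 in hi *; apply/andP; split; lra.
Qed.

Lemma prob_crowded_cell n i : (0 < n)%N -> (i < num_cells R n)%N ->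
  (P [set t | (32 <= cell_count (U^~ t) n i)%R] <= (expR 1 / n%:R ^+ 4)%:E)%E.
Proof.
move=> n0 iG; have [mU indepU _] := unifU.
have nR : 0 < n%:R :> R by rewrite ltr0n.
set G := num_cells R n in iG *; have G0 : 0 < G%:R :> R by rewrite ltr0n (leq_ltn_trans _ iG).
pose c : R := G%:R / n%:R.
have c0 : 0 < c by rewrite divr_gt0.
have /andP[i0 _] := natr_div_itv01 (R := R) (ltnW iG).
have /andP[_ i1] := natr_div_itv01 (R := R) iG.
have ii := ler_natr_div (R := R) G (leqnSn i).
have l0 : 0 < ln (1 + c) by rewrite ln_gt0//; lra.
have := hits_chernoff mU indepU (measurable_itv `]i%:R / G%:R, i.+1%:R / G%:R])
  (fun k => uniform_probability_itv unifU k i0 ii i1) (ln (1 + c)) (ln (1 + c) * 32)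
  (iota_uniq 0 (n - 0)).
rewrite size_iota subn0 natrS_div_sub lnK ?posrE; last by lra.
rewrite (_ : n%:R * G%:R^-1 * (1 + c - 1) = 1); last by rewrite /c; field; rewrite !gt_eqF.
have -> : [set t | ln (1 + c) * 32 <= ln (1 + c) *
    hits U `]i%:R / G%:R, i.+1%:R / G%:R] (iota 0 n) t] = [set t | 32 <= cell_count (U^~ t) n i].
  apply/seteqP; split => t /=; rewrite ler_pM2l// /cell_count count_le_sub// /hits.
    by under eq_bigr do rewrite indicE mem_setE in_itv/=; rewrite /index_iota subn0.
  by under [in X in _ -> X]eq_bigr do rewrite indicE mem_setE in_itv/=; rewrite /index_iota subn0.
move=> /le_trans; apply; rewrite lee_fin expRD ler_wpM2l ?expR_ge0//.
rewrite mulrC expRN expRM_natl lnK ?posrE; last by lra.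
have n4 : 0 < n%:R ^+ 4 :> R by rewrite exprn_gt0.
have c32 : n%:R ^+ 4 <= (1 + c) ^+ 32.
  rewrite -[n%:R]root8X8 -exprM lerXn2r ?nnegrE ?root8_ge0//; first lra.
  have /andP[+ _] := num_cells_bounds n0; rewrite mulrC -ler_pdivlMr// -/G -/c; lra.
by rewrite lef_pV2 ?posrE//; apply: lt_le_trans c32.
Qed.

Lemma ae_sparse_cells : {ae P, forall t, \forall n \near \oo, forall i, (i < num_cells R n)%N ->
  cell_count (U^~ t) n i < 32}.
Proof.
pose A n i := [set t | 32 <= `|cell_count (U^~ t) n i|].
have AE n i : A n i = [set t | 32 <= cell_count (U^~ t) n i].
  apply/funext => t; rewrite /A/= ger0_norm// /cell_count count_le_sub ?ler_natr_div//.
  exact: sumr_ge0.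
have mA n i : measurable (A n i).
  apply: measurable_norm_ge; apply: measurable_funB; exact: (measurable_count_le unifU).
suff: {ae P, forall t, \forall n \near \oo, ~ (\bigcup_(i < num_cells R n) A n i) t}.
  apply: filterS => t; apply: filterS => n nA i iG.
  by rewrite ltNge; apply/negP => crowded; apply: nA; exists i; rewrite ?AE.
apply: (@borel_cantelli_inv_sqr _ _ _ _ _ (2 * expR 1)).
  by move=> n; apply: fin_bigcup_measurable.
exists 1 => // n /= n0; have nR : 0 < n%:R :> R by rewrite ltr0n.
apply: (@le_trans _ _ ((num_cells R n)%:R * (expR 1 / n%:R ^+ 4))%:E).
  by apply: probability_bigcup_le => // i iG; rewrite AE; exact: prob_crowded_cell.
rewrite lee_fin.
have -> : 2 * expR 1 / n%:R ^+ 2 = 2 * (n%:R * n%:R) * (expR 1 / n%:R ^+ 4) :> R.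
  by field; rewrite gt_eqF.
rewrite ler_wpM2r ?divr_ge0 ?expR_ge0 ?exprn_ge0//.
have /andP[_ /le_trans] := num_cells_bounds n0; apply.
by rewrite ler_pM2l// ler_pM2l// root8_le.
Qed.

End CrowdedCells.

Section DyadicChaining.
Context {R : realType}.
Variables (x : nat -> R) (j : nat).

Definition time_mesh (l : nat) : nat := (2 ^ (2 * j - l))%N.

Definition dyadic (l c : nat) : R := c%:R / 2 ^+ l.

(* Summable in [l], whereas [threshold l ^ 2 / (8 time_mesh l)] grows like [(49/32)^l ln j],
   which beats the [4^l] nodes of level [l]. *)
Definition threshold (l : nat) : R := 8 * 2 ^+ j * Num.sqrt (ln j%:R) * (7 / 8) ^+ l.

Definition node_dev l a c : R := count_dev x 0 (a * time_mesh l) (dyadic l c).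

Definition time_jump l a c : R :=
  count_dev x (a * time_mesh l) (a.+1 * time_mesh l) (dyadic l c).

Definition space_jump l a c : R := node_dev l a c.+1 - node_dev l a c.

Definition chained : Prop := forall l a c, (l <= j)%N -> (a <= 2 ^ l)%N -> (c <= 2 ^ l)%N ->
  `|time_jump l a c| <= threshold l /\ ((c < 2 ^ l)%N -> `|space_jump l a c| <= threshold l).

Lemma dyadic_itv01 l c : (c <= 2 ^ l)%N -> 0 <= dyadic l c <= 1.
Proof.
move=> c2; rewrite divr_ge0 ?exprn_ge0//= ler_pdivrMr ?exprn_gt0// mul1r.
by rewrite -natrX ler_nat.
Qed.

Lemma dyadicS_sub l c : dyadic l c.+1 - dyadic l c = (2 ^+ l)^-1.
Proof. by rewrite /dyadic -natrX natrS_div_sub. Qed.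

Lemma ler_dyadicS l c : dyadic l c <= dyadic l c.+1.
Proof. by rewrite -subr_ge0 dyadicS_sub invr_ge0 exprn_ge0. Qed.

Lemma threshold_ge0 l : 0 <= threshold l.
Proof. by rewrite !mulr_ge0 ?sqrtr_ge0 ?exprn_ge0. Qed.

Lemma thresholdE l : threshold l = threshold 0 * (7 / 8) ^+ l.
Proof. by rewrite /threshold expr0 mulr1. Qed.

Lemma node_dev_double l a c : (l < j)%N -> node_dev l a c = node_dev l.+1 a.*2 c.*2.
Proof.
move=> lj; rewrite /node_dev /dyadic -!muln2 natrM exprS.
have -> : time_mesh l = (2 * time_mesh l.+1)%N.
  rewrite /time_mesh -expnS; congr (2 ^ _)%N; rewrite -subSn ?subSS//.
  by rewrite (leq_trans lj)// leq_pmull.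
by rewrite mulnA; congr (count_dev _ _ _ _); field; rewrite expf_neq0.
Qed.

Lemma double_half_le a : (a./2.*2 <= a)%N.
Proof. by rewrite -{2}(odd_double_half a) leq_addl. Qed.

Hypothesis chained_x : chained.

Lemma chained_space_step l a c : (l <= j)%N -> (a <= 2 ^ l)%N -> (c <= 2 ^ l)%N ->
  `|node_dev l a c| <= `|node_dev l a c./2.*2| + threshold l.
Proof.
move=> lj a2 c2; rewrite -{1}(odd_double_half c); case oc: (odd c); last first.
  by rewrite add0n lerDl threshold_ge0.
have cl : (c./2.*2 < 2 ^ l)%N by apply: leq_trans c2; rewrite -{2}(odd_double_half c) oc.
have -> : node_dev l a (1 + c./2.*2) = node_dev l a c./2.*2 + space_jump l a c./2.*2.
  by rewrite add1n /space_jump addrC subrK.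
apply: le_trans (ler_normD _ _) _; rewrite lerD2l.
by have [_] := chained_x lj a2 (ltnW cl); exact.
Qed.

Lemma chained_time_step l a c : (l <= j)%N -> (a <= 2 ^ l)%N -> (c <= 2 ^ l)%N ->
  `|node_dev l a c| <= `|node_dev l a./2.*2 c| + threshold l.
Proof.
move=> lj a2 c2; have a2' := leq_trans (double_half_le a) a2.
rewrite -{1}(odd_double_half a); case: (odd a); last by rewrite add0n lerDl threshold_ge0.
rewrite add1n /node_dev (@count_dev_cat _ _ 0 (a./2.*2 * time_mesh l))//; last first.
  by rewrite leq_mul2r leqnSn orbT.
apply: le_trans (ler_normD _ _) _; rewrite lerD2l.
by have [] := chained_x lj a2' c2.
Qed.

Lemma chained_node_dev l a c : (l <= j)%N -> (a <= 2 ^ l)%N -> (c <= 2 ^ l)%N ->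
  `|node_dev l a c| <= 16 * threshold 0 * (1 - (7 / 8) ^+ l.+1).
Proof.
have thr0 := threshold_ge0 0.
elim: l a c => [|l IH] a c lj.
  rewrite expn0 => a1 c1.
  have -> : 16 * threshold 0 * (1 - (7 / 8) ^+ 1) = 2 * threshold 0 by rewrite expr1; field.
  case: a a1 => [_|[_|//]].
    by rewrite /node_dev mul0n /count_dev /count_le big_geq// mul0r subrr normr0 mulr_ge0.
  by have [] := @chained_x 0 0 c lj isT c1; rewrite /time_jump /node_dev mul0n; lra.
move=> a2 c2; have a2' := leq_trans (double_half_le a) a2.
have half_le b : (b <= 2 ^ l.+1)%N -> (b./2 <= 2 ^ l)%N.
  by move=> b2; rewrite -(doubleK (2 ^ l)%N) half_leq// -mul2n -expnS.
have := IH _ _ (ltnW lj) (half_le _ a2) (half_le _ c2); rewrite node_dev_double// => parent.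
apply: le_trans (chained_time_step lj a2 c2) _.
apply: le_trans (lerD (chained_space_step lj a2' c2) (lexx _)) _.
apply: le_trans (lerD (lerD parent (lexx _)) (lexx _)) _.
rewrite [threshold l.+1]thresholdE [(7 / 8) ^+ l.+2]exprS.
move: ((7 / 8) ^+ l.+1) (threshold 0) => y w.
by rewrite le_eqVlt; apply/orP; left; apply/eqP; field.
Qed.

Lemma chained_dyadic_dev n c : (n <= 4 ^ j)%N -> (c <= 2 ^ j)%N ->
  `|count_dev x 0 n (dyadic j c)| <= 16 * threshold 0 + 2 ^+ j.
Proof.
move=> n4 c2; pose a := (n %/ 2 ^ j)%N.
have mesh_j : time_mesh j = (2 ^ j)%N by rewrite /time_mesh mul2n -addnn addnK.
have n2 : (a * 2 ^ j <= n)%N by exact: leq_divM.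
have a2 : (a <= 2 ^ j)%N.
  by rewrite -[leqRHS](@mulnK _ (2 ^ j)) ?expn_gt0// leq_div2r// -expnMn.
rewrite (@count_dev_cat _ _ 0 (a * 2 ^ j))//.
apply: le_trans (ler_normD _ _) (lerD _ _).
  have := chained_node_dev (leqnn j) a2 c2; rewrite /node_dev mesh_j => /le_trans; apply.
  by rewrite ler_piMr ?gerBl ?exprn_ge0// mulr_ge0// threshold_ge0.
apply: le_trans (count_dev_le _ _ _ (dyadic_itv01 c2)) _.
rewrite -natrX ler_nat leq_subLR {1}(divn_eq n (2 ^ j)) leq_add2l.
by rewrite ltnW// ltn_mod expn_gt0.
Qed.

Lemma chained_dev n (u : R) : (n <= 4 ^ j)%N -> 0 <= u <= 1 ->
  `|count_dev x 0 n u| <= 16 * threshold 0 + 2 * 2 ^+ j.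
Proof.
move=> n4 /andP[u0 u1]; have p0 : 0 < 2 ^+ j :> R by rewrite exprn_gt0.
pose c := Num.truncn (u * 2 ^+ j).
have /andP[cu uc] : c%:R <= u * 2 ^+ j < c.+1%:R.
  by apply: truncn_itv; rewrite mulr_ge0// ltW.
have [c2|c2] := ltnP c (2 ^ j); last first.
  have -> : u = dyadic j (2 ^ j).
    apply/eqP; rewrite eq_le /dyadic natrX divff ?gt_eqF// u1 /=.
    by rewrite -(ler_pM2r p0) mul1r; apply: le_trans cu; rewrite -natrX ler_nat.
  by apply: le_trans (chained_dyadic_dev n4 (leqnn _)) _; lra.
have drift (v w : R) : v <= w -> w - v <= (2 ^+ j)^-1 ->
    count_dev x 0 n v - 2 ^+ j <= count_dev x 0 n w.
  move=> vw wv; apply: le_trans (count_dev_drift x 0 n vw); rewrite lerD2l lerN2 subn0.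
  apply: (@le_trans _ _ (4 ^+ j * (2 ^+ j)^-1)).
    by apply: ler_pM => //; [rewrite subr_ge0|rewrite -natrX ler_nat].
  by rewrite (_ : 4 = 2 * 2 :> R) ?exprMn ?mulfK ?gt_eqF//; ring.
have lo : dyadic j c <= u by rewrite ler_pdivrMr.
have hi : u <= dyadic j c.+1 by rewrite ler_pdivlMr// ltW.
have gap := dyadicS_sub j c.
have := chained_dyadic_dev n4 (ltnW c2); have := chained_dyadic_dev n4 c2.
have drift_lo := drift _ _ lo; have drift_hi := drift _ _ hi.
rewrite !ler_norml => /andP[_ dev_hi] /andP[dev_lo _].
by apply/andP; split; [have := drift_lo _|have := drift_hi _]; lra.
Qed.

End DyadicChaining.

Lemma ln_nat_ge1 {R : realType} j : (4 <= j)%N -> 1 <= ln j%:R :> R.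
Proof.
move=> j4; rewrite -[leLHS]expRK ler_ln ?posrE ?expR_gt0 ?ltr0n//; last exact: leq_trans j4.
by apply: le_trans expR1_le4 _; rewrite ler_nat.
Qed.

Section IteratedLogarithm.
Context {d} {T : measurableType d} {R : realType} (P : probability T R).
Variable U : nat -> T -> R.
Hypothesis unifU : uniform_sample P U.

Let expr2_mesh j l : (l <= j)%N -> (time_mesh j l)%:R = 2 ^+ j * 2 ^+ j / 2 ^+ l :> R.
Proof.
move=> lj; rewrite natrX -exprD addnn -mul2n expfB_cond// pnatr_eq0/=.
by rewrite (leq_trans lj)// leq_pmull.
Qed.

Lemma threshold_le_mesh j l : (196 <= j)%N -> (l <= j)%N ->
  threshold j l <= 4 * (time_mesh j l)%:R :> R.
Proof.
move=> j196 lj; have l1 : 1 <= ln j%:R :> R by apply: ln_nat_ge1; exact: leq_trans j196.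
have jR : 196 <= j%:R :> R by rewrite ler_nat.
have p0 : 0 < 2 ^+ j :> R by rewrite exprn_gt0.
have -> : 4 * (time_mesh j l)%:R = 4 * 2 ^+ j * (2 ^+ j / 2 ^+ l) :> R.
  by rewrite expr2_mesh//; ring.
have -> : threshold j l = 4 * 2 ^+ j * (2 * Num.sqrt (ln j%:R) * (7 / 8) ^+ l) :> R.
  by rewrite /threshold; ring.
rewrite ler_pM2l ?mulr_gt0// ler_pdivlMr ?exprn_gt0// -[leLHS]mulrA -exprMn.
rewrite (_ : 7 / 8 * 2 = 7 / 4 :> R); last by field.
have -> : 2 ^+ j = (1 + 1 / 7) ^+ j * (7 / 4) ^+ j :> R.
  by rewrite -exprMn; congr (_ ^+ _); field.
apply: ler_pM; rewrite ?mulr_ge0 ?sqrtr_ge0 ?exprn_ge0//; last first.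
  by apply: ler_weXn2l => //; lra.
apply: le_trans (bernoulli_ineq _ _); last by lra.
rewrite -(@ler_pXn2r _ 2)// ?nnegrE ?mulr_ge0 ?sqrtr_ge0 ?addr_ge0 ?mulr_ge0//.
rewrite exprMn sqr_sqrtr; last lra.
have : ln j%:R < j%:R :> R by apply: ln_sublinear; lra.
by move: (ln _) => y; nra.
Qed.

Lemma threshold_tail j l : (4 <= j)%N -> (l <= j)%N ->
  expR (- (threshold j l ^+ 2 / (8 * (time_mesh j l)%:R))) <= (4 ^+ l)^-1 * (j%:R ^+ 8)^-1 :> R.
Proof.
move=> j4 lj; have l1 : 1 <= ln j%:R :> R by exact: ln_nat_ge1.
have j1 : 4 <= j%:R :> R by rewrite ler_nat.
have j0 : 0 < j%:R :> R by lra.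
have -> : threshold j l ^+ 2 / (8 * (time_mesh j l)%:R) = 8 * ln j%:R * (49 / 32) ^+ l :> R.
  rewrite /threshold expr2_mesh//.
  have -> : (49 / 32) ^+ l = (7 / 8) ^+ l * (7 / 8) ^+ l * 2 ^+ l :> R.
    by rewrite -!exprMn; congr (_ ^+ _); field.
  set y := Num.sqrt (ln j%:R); have -> : ln j%:R = y ^+ 2 by rewrite sqr_sqrtr//; lra.
  by field; rewrite !expf_neq0.
rewrite expRN -invfM lef_pV2 ?posrE ?expR_gt0 ?mulr_gt0 ?exprn_gt0//.
apply: (@le_trans _ _ (expR ((8 + l * 4)%N%:R * ln j%:R))); last first.
  rewrite ler_expR mulrAC ler_wpM2r//; first lra.
  rewrite natrD natrM (_ : 49 / 32 = 1 + 17 / 32 :> R); last by field.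
  have : 1 + l%:R * (17 / 32) <= (1 + 17 / 32) ^+ l :> R by apply: bernoulli_ineq; lra.
  by have : 0 <= l%:R :> R by []; move: (l%:R : R) (_ ^+ l) => w y; lra.
rewrite expRM_natl lnK ?posrE// exprD [leLHS]mulrC ler_wpM2l ?exprn_ge0 ?(ltW j0)//.
rewrite mulnC exprM lerXn2r ?nnegrE ?exprn_ge0 ?(ltW j0)//.
by apply: (le_trans j1); apply: ler_eXnr => //; lra.
Qed.

Let time_event j l a c : set T := [set t | threshold j l <= `|time_jump (U^~ t) j l a c|].

Let space_event j l a c : set T :=
  if (c < 2 ^ l)%N then [set t | threshold j l <= `|space_jump (U^~ t) j l a c|] else set0.

Let measurable_time_event j l a c : measurable (time_event j l a c).
Proof. by apply: measurable_norm_ge; exact: (measurable_count_dev unifU). Qed.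

Let measurable_space_event j l a c : measurable (space_event j l a c).
Proof.
rewrite /space_event; case: ifP => // _; apply: measurable_norm_ge.
by apply: measurable_funB; exact: (measurable_count_dev unifU).
Qed.

Lemma prob_jump j l a c : (196 <= j)%N -> (l <= j)%N -> (a <= 2 ^ l)%N -> (c <= 2 ^ l)%N ->
  (P (time_event j l a c `|` space_event j l a c) <= (4 * ((4 ^+ l)^-1 * (j%:R ^+ 8)^-1))%:E)%E.
Proof.
move=> j196 lj a2 c2; have /andP[c0 c1] := dyadic_itv01 (R := R) c2.
have V0 : 0 < (time_mesh j l)%:R :> R by rewrite ltr0n expn_gt0.
have tail := threshold_tail (leq_trans (isT : 4 <= 196)%N j196) lj.
have hz : 0 <= (threshold j l : R) <= 4 * (time_mesh j l)%:R.
  by rewrite threshold_ge0 threshold_le_mesh.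
rewrite (_ : 4 * _ = 2 * ((4 ^+ l)^-1 * (j%:R ^+ 8)^-1) + 2 * ((4 ^+ l)^-1 * (j%:R ^+ 8)^-1));
  last by ring.
rewrite EFinD.
apply: le_trans (measureU2 P (measurable_time_event _ _ _ _) (measurable_space_event _ _ _ _)) _.
apply: leeD.
  apply: le_trans (count_dev_bernstein unifU (V := (time_mesh j l)%:R) _ _ V0 hz) _.
  - exact: dyadic_itv01.
  - by rewrite mulSn addnK ler_piMr.
  - by rewrite lee_fin ler_pM2l.
rewrite /space_event; case: ifPn => [c2'|_]; last first.
  by rewrite measure0 lee_fin !mulr_ge0// invr_ge0 exprn_ge0.
have /andP[_ c1'] := dyadic_itv01 (R := R) c2'.
apply: le_trans (count_dev_sub_bernstein unifU (V := (time_mesh j l)%:R)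
  c0 (ler_dyadicS l c) c1' _ V0 hz) _; last by rewrite lee_fin ler_pM2l.
rewrite subn0 dyadicS_sub natrM mulrAC ler_piMl//.
by rewrite ler_pdivrMr ?exprn_gt0// mul1r -natrX ler_nat.
Qed.

Let unchained j : set T := \bigcup_(l < j.+1) \bigcup_(a < (2 ^ l).+1) \bigcup_(c < (2 ^ l).+1)
  (time_event j l a c `|` space_event j l a c).

Let measurable_unchained j : measurable (unchained j).
Proof.
by do 3 (apply: fin_bigcup_measurable => // ? _); exact: measurableU.
Qed.

Lemma prob_unchained j : (196 <= j)%N -> (P (unchained j) <= (32 / j%:R ^+ 2)%:E)%E.
Proof.
move=> j196; have jR : 196 <= j%:R :> R by rewrite ler_nat.
apply: (@le_trans _ _ (j.+1%:R * (16 / j%:R ^+ 8))%:E).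
  apply: probability_bigcup_le => l lj.
    by do 2 (apply: fin_bigcup_measurable => // ? _); exact: measurableU.
  pose e : R := 4 * ((4 ^+ l)^-1 * (j%:R ^+ 8)^-1).
  apply: (@le_trans _ _ ((2 ^ l).+1%:R * ((2 ^ l).+1%:R * e))%:E).
    apply: probability_bigcup_le => a a2.
      by apply: fin_bigcup_measurable => // ? _; exact: measurableU.
    apply: probability_bigcup_le => c c2; first exact: measurableU.
    exact: prob_jump.
  rewrite lee_fin /e -natr1 natrX (_ : 4 = 2 * 2 :> R) ?exprMn; last by ring.
  have p1 : 1 <= 2 ^+ l :> R by rewrite exprn_ege1// ler1n.
  have q0 : 0 < j%:R ^+ 8 :> R by rewrite exprn_gt0//; lra.
  move: (2 ^+ l) (j%:R ^+ 8) p1 q0 => x y x1 y0; rewrite -subr_ge0.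
  have -> : 16 / y - (x + 1) * ((x + 1) * (2 * 2 * ((x * x)^-1 / y))) =
      4 * ((2 * x - (x + 1)) * (2 * x + (x + 1))) / (x * x * y).
    by field; rewrite !gt_eqF//; lra.
  by rewrite divr_ge0 ?mulr_ge0//; lra.
rewrite lee_fin -natr1 -subr_ge0.
have -> : 32 / j%:R ^+ 2 - (j%:R + 1) * (16 / j%:R ^+ 8) =
  16 * (2 * j%:R ^+ 6 - (j%:R + 1)) / j%:R ^+ 8 :> R by field; rewrite gt_eqF//; lra.
rewrite divr_ge0 ?exprn_ge0// mulr_ge0// subr_ge0.
have : j%:R <= j%:R ^+ 6 :> R by apply: ler_eXnr => //; lra.
by lra.
Qed.

Lemma ae_chained : {ae P, forall t, \forall j \near \oo, chained (U^~ t) j}.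
Proof.
have : {ae P, forall t, \forall j \near \oo, ~ unchained j t}.
  apply: (@borel_cantelli_inv_sqr _ _ _ _ _ 32) => //.
  by exists 196 => // j /= j196; exact: prob_unchained.
apply: filterS => t; apply: filterS => j ok l a c lj a2 c2.
split; [|move=> c2'];
  rewrite leNgt; apply/negP => /ltW jump; apply: ok;
  exists l; rewrite /= ?ltnS//; exists a; rewrite /= ?ltnS//; exists c; rewrite /= ?ltnS//.
- by left.
- by right; rewrite /space_event c2'.
Qed.

End IteratedLogarithm.

Section LilScale.
Context {R : realType}.

Definition lil_scale n : R := Num.sqrt (n%:R * ln (ln n%:R)).

Lemma chained_lil (x : nat -> R) (k n : nat) (u : R) :
  (196 <= k)%N -> (4 ^ k <= n <= 4 ^ k.+1)%N -> chained x k.+1 -> 0 <= u <= 1 ->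
  `|count_dev x 0 n u| <= 400 * lil_scale n.
Proof.
move=> k196 /andP[kn nk] chx u01.
have kR : 196 <= k%:R :> R by rewrite ler_nat.
have k0 : 0 < k%:R :> R by lra.
have nR : 0 < n%:R :> R by rewrite ltr0n (leq_trans _ kn)// expn_gt0.
have lnk : k%:R <= ln n%:R :> R.
  apply: (@le_trans _ _ (ln (4 ^+ k))).
    rewrite lnXn// -[leRHS]mulr_natl ler_peMr//.
    by apply: (@ln_nat_ge1 R).
  by rewrite ler_ln ?posrE ?exprn_gt0// -natrX ler_nat.
have lnkS : ln k.+1%:R <= 2 * ln (ln n%:R) :> R.
  apply: (@le_trans _ _ (ln (k%:R ^+ 2))).
    have kS : k.+1%:R <= k%:R ^+ 2 :> R by rewrite -natr1; nra.
    by rewrite ler_ln// posrE ?exprn_gt0.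
  by rewrite lnXn// -[leLHS]mulr_natl ler_wpM2l// ler_ln ?posrE//; lra.
have two_pow : 2 ^+ k.+1 <= 2 * Num.sqrt n%:R :> R.
  rewrite exprS ler_pM2l// -(@ler_pXn2r _ 2)// ?nnegrE ?exprn_ge0 ?sqrtr_ge0//.
  by rewrite sqr_sqrtr// -exprM mulnC exprM -!natrX ler_nat.
have sqrt_ln : Num.sqrt (ln k.+1%:R) <= 3 / 2 * Num.sqrt (ln (ln n%:R)) :> R.
  have l0 : 0 <= ln (ln n%:R) :> R by apply: ln_ge0; lra.
  rewrite -(@ler_pXn2r _ 2)// ?nnegrE ?mulr_ge0 ?sqrtr_ge0//.
  rewrite exprMn !sqr_sqrtr//; last by rewrite ln_ge0// ler1n.
  by apply: le_trans lnkS _; rewrite ler_wpM2r//; lra.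
have sqrt_ln1 : 1 <= Num.sqrt (ln k.+1%:R) :> R.
  rewrite -[leLHS]sqrtr1 ler_wsqrtr//; apply: ln_nat_ge1; exact: leq_trans (leqW k196).
apply: le_trans (chained_dev chx nk u01) _; rewrite /threshold expr0 mulr1 /lil_scale sqrtrM//.
have p0 : 0 < 2 ^+ k.+1 :> R by rewrite exprn_gt0.
have : 2 ^+ k.+1 * Num.sqrt (ln k.+1%:R) <=
    2 * Num.sqrt n%:R * (3 / 2 * Num.sqrt (ln (ln n%:R))) :> R.
  by apply: ler_pM; rewrite ?sqrtr_ge0 ?exprn_ge0.
by move: (Num.sqrt (ln k.+1%:R)) sqrt_ln1 (2 ^+ k.+1) p0 => y y1 z z0; nra.
Qed.

End LilScale.

Section RegularSample.
Context {d} {T : measurableType d} {R : realType} (P : probability T R).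
Variable U : nat -> T -> R.
Hypothesis unifU : uniform_sample P U.

Definition regular_sample (x : nat -> R) n : Prop :=
  [/\ forall u, 0 <= u <= 1 -> `|count_dev x 0 n u| <= 400 * lil_scale n,
      forall i j, (i <= j <= n)%N ->
        `|count_dev x 0 n (j%:R / n%:R) - count_dev x 0 n (i%:R / n%:R)| <=
          osc_bound (ln n%:R) (j%:R - i%:R) &
      forall i, (i < num_cells R n)%N -> cell_count x n i < 32].

Lemma ae_iterated_log : {ae P, forall t, \forall n \near \oo, forall u, 0 <= u <= 1 ->
  `|count_dev (U^~ t) 0 n u| <= 400 * lil_scale n}.
Proof.
apply: filterS (ae_chained unifU) => t [j0 _ ok].
exists (4 ^ maxn 196 j0)%N => // n /= nj u u01.
have n0 : (0 < n)%N by apply: leq_trans nj; rewrite expn_gt0.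
have /andP[kn nk] := trunc_log_bounds (isT : 1 < 4)%N n0.
have : (maxn 196 j0 <= trunc_log 4 n)%N by exact: trunc_log_max.
rewrite geq_max => /andP[k196 kj]; apply: chained_lil k196 _ _ u01; first by rewrite kn ltnW.
by apply: ok; rewrite /= leqW.
Qed.

Lemma ae_regular_sample : {ae P, forall t, \forall n \near \oo, regular_sample (U^~ t) n}.
Proof.
apply: filterS (filterI ae_iterated_log
  (filterI (ae_oscillation unifU) (ae_sparse_cells unifU))) => t [lil [osc cells]].
by near=> n; split; near: n.
Unshelve. all: by end_near. Qed.

Lemma ae_uniform_itv01 : {ae P, forall t, forall i, 0 < U i t <= 1}.
Proof.
have [mU _ _] := unifU.
have outside i : P.-negligible (~` (U i @^-1` `]0, 1])).
  have m : measurable (U i @^-1` `]0, 1]) by rewrite -[X in measurable X]setTI; exact: mU.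
  apply/negligibleP; first exact: measurableC.
  apply: etrans (probability_setC P m) _.
  by rewrite (uniform_probability_itv unifU i)// subr0 subee.
apply: negligibleS (negligible_bigcup outside) => t /= /existsNP[i Ui].
by exists i.
Qed.

End RegularSample.

(** * The Bahadur-Kiefer bound *)

Section WindowSums.
Context {R : realType}.
Implicit Types (x y : R).

Lemma sumr_window_le x y n : x <= y + 1 ->
  \sum_(0 <= j < n) (x <= j%:R <= y)%R%:R <= y - x + 1.
Proof.
move=> xy; pose clamp (j : nat) : R := Num.max x (Num.min j%:R (y + 1)).
apply: (@le_trans _ _ (\sum_(0 <= j < n) (clamp j.+1 - clamp j))).
  apply: ler_sum => j _; rewrite /clamp -natr1; case: (boolP (x <= _ <= y)) => [/andP[xj jy]|_].
    by rewrite !min_l ?max_r/= ?mulr1n//; lra.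
  by rewrite subr_ge0 le_max2 ?le_min2//; lra.
rewrite telescope_sumr// /clamp.
have : x <= Num.max x (Num.min 0%:R (y + 1)) by rewrite le_max lexx.
have : Num.max x (Num.min n%:R (y + 1)) <= y + 1 by rewrite ge_max xy ge_min lexx orbT.
lra.
Qed.

Lemma ler_norm_sum_window (f : nat -> R) (c x y : R) n : x <= y + 1 -> 0 <= c ->
  (forall j, (j < n)%N -> `|f j| <= c) ->
  (forall j, (j < n)%N -> f j != 0 -> x <= j%:R <= y) ->
  `|\sum_(0 <= j < n) f j| <= c * (y - x + 1).
Proof.
move=> xy c0 fc fw; apply: le_trans (ler_norm_sum _ _ _) _.
apply: (@le_trans _ _ (\sum_(0 <= j < n) c * (x <= j%:R <= y)%R%:R)).
  apply: ler_sum_nat => j /= jn.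
  have [->|f0] := eqVneq (f j) 0; first by rewrite normr0 mulr_ge0.
  by rewrite fw// mulr1 fc.
by rewrite -mulr_sumr ler_wpM2l// sumr_window_le.
Qed.

Lemma mesh_cell (x : R) (m : nat) : (0 < m)%N -> 0 < x <= 1 ->
  exists i, [/\ (i < m)%N, i%:R / m%:R < x & x <= i.+1%:R / m%:R].
Proof.
move=> m0 /andP[x0 x1]; have mR : 0 < m%:R :> R by rewrite ltr0n.
have ex : exists i, (m%:R * x <= i%:R) by exists m; rewrite ler_piMr// ltW.
case: (ex_minnP ex) => -[|i] mi imin; first by move: mi; rewrite leNgt mulr_gt0.
exists i; split.
- by apply: imin; rewrite ler_piMr// ltW.
- by rewrite ltr_pdivrMr// ltNge mulrC; apply/negP => /imin; rewrite ltnn.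
- by rewrite ler_pdivlMr// mulrC.
Qed.

End WindowSums.

Section OrderedSample.
Context {R : realType}.
Variables (n : nat) (V : nat -> R).

Definition ordered_sample : Prop :=
  [/\ (0 < n)%N, forall k l, (k <= l)%N -> (l < n)%N -> V k <= V l &
      forall k, (k < n)%N -> 0 < V k <= 1].

Hypothesis ordV : ordered_sample.

Let n0 : (0 < n)%N. Proof. by case: ordV. Qed.
Let nR : 0 < n%:R :> R. Proof. by rewrite ltr0n. Qed.
Let V_le k l : (k <= l)%N -> (l < n)%N -> V k <= V l. Proof. by case: ordV => _ + _; exact. Qed.
Let V01 k : (k < n)%N -> 0 < V k <= 1. Proof. by case: ordV => _ _; exact. Qed.

Lemma ordered_count_ge k x : (k < n)%N -> V k <= x -> k.+1%:R <= count_le V 0 n x.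
Proof.
move=> kn Vx; rewrite /count_le (big_cat_nat (leq0n k.+1) kn)/=.
rewrite (eq_big_nat _ _ (F2 := fun=> 1)); last first.
  by move=> i; rewrite ltnS => /andP[_ ik]; rewrite (le_trans (V_le ik kn) Vx).
by rewrite sumr_const_nat subn0 lerDl sumr_ge0.
Qed.

Lemma ordered_count_le k x : (k < n)%N -> x < V k -> count_le V 0 n x <= k%:R.
Proof.
move=> kn Vx; rewrite /count_le (big_cat_nat (leq0n k) (ltnW kn))/=.
rewrite [X in _ + X]big1_seq ?addr0; last first.
  move=> i; rewrite mem_index_iota => /andP[_ /andP[ki iN]].
  by rewrite leNgt (lt_le_trans Vx (V_le ki iN)).
by case/andP: (count_le_bounds V 0 k x); rewrite subn0.
Qed.

Definition grid_dev j : R := count_dev V 0 n (j%:R / n%:R).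

Lemma count_le_grid j : count_le V 0 n (j%:R / n%:R) = grid_dev j + j%:R.
Proof. by rewrite /grid_dev /count_dev subn0; field; rewrite gt_eqF. Qed.

Lemma ordered_rank_cell j : (j < n)%N -> exists i,
  [/\ (i < n)%N, i%:R < n%:R * V j <= i.+1%:R, grid_dev i + i%:R <= j%:R &
      j.+1%:R <= grid_dev i.+1 + i.+1%:R].
Proof.
move=> jn; have [i [iN iV Vi]] := mesh_cell n0 (V01 jn).
exists i; split => //.
- by move: iV Vi; rewrite ltr_pdivrMr// ler_pdivlMr// mulrC => -> ->.
- by rewrite -count_le_grid; exact: ordered_count_le.
- by rewrite -count_le_grid; exact: ordered_count_ge.
Qed.

Section Modulus.
Variables (Lam : R) (w : R -> R).
Hypothesis w_homo : {homo w : x y / x <= y}.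
Hypothesis grid_dev_le : forall j, (j <= n)%N -> `|grid_dev j| <= Lam.
Hypothesis grid_dev_osc : forall i j, (i <= j <= n)%N ->
  `|grid_dev j - grid_dev i| <= w (j%:R - i%:R).

Lemma grid_dev_sub i j (r : R) : (i <= n)%N -> (j <= n)%N -> `|j%:R - i%:R| <= r ->
  `|grid_dev j - grid_dev i| <= w r.
Proof.
move=> iN jN ijr; have [ij|/ltnW ji] := leqP i j.
  by apply: le_trans (grid_dev_osc _) (w_homo (le_trans (ler_norm _) ijr)); rewrite ij.
rewrite distrC; rewrite distrC in ijr.
by apply: le_trans (grid_dev_osc _) (w_homo (le_trans (ler_norm _) ijr)); rewrite ji.
Qed.

Lemma quantile_dev j : (j < n)%N -> `|n%:R * V j - j.+1%:R| <= Lam + 1.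
Proof.
move=> jn; have [i [iN /andP[iV Vi] lo hi]] := ordered_rank_cell jn.
have := grid_dev_le (ltnW iN); have := grid_dev_le iN.
rewrite -!natr1 in Vi hi *.
by rewrite !ler_norml => /andP[? ?] /andP[? ?]; apply/andP; split; lra.
Qed.

Lemma bahadur_kiefer j : (j < n)%N ->
  `|n%:R * V j - j.+1%:R + grid_dev j| <= w (Lam + 2) + 2.
Proof.
move=> jn; have [i [iN /andP[iV Vi] lo hi]] := ordered_rank_cell jn.
have := grid_dev_le (ltnW iN); have := grid_dev_le iN.
rewrite -[i.+1%:R]natr1 -[j.+1%:R]natr1 in Vi hi *.
rewrite !ler_norml => /andP[? ?] /andP[? ?].
have osc_i : `|grid_dev i - grid_dev j| <= w (Lam + 2).
  apply: grid_dev_sub; rewrite ?(ltnW jn) ?(ltnW iN)//.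
  by rewrite ler_norml; apply/andP; split; lra.
have osc_iS : `|grid_dev i.+1 - grid_dev j| <= w (Lam + 2).
  apply: grid_dev_sub; rewrite ?(ltnW jn)// -natr1.
  by rewrite ler_norml; apply/andP; split; lra.
move: osc_i osc_iS; rewrite !ler_norml => /andP[? ?] /andP[? ?].
by apply/andP; split; lra.
Qed.

Lemma spacing_gap_modulus (s e : nat) : (s <= e)%N -> (e < n)%N ->
  (e - s)%N%:R + 1 <= n%:R * (V e - V s) + 2 + w (n%:R * (V e - V s) + 2).
Proof.
move=> se en; set r := _ + 2; have sn := leq_ltn_trans se en.
have [i [iN /andP[i1 i2] _ i3]] := ordered_rank_cell en.
have [j [jN /andP[j1 j2] j3 _]] := ordered_rank_cell sn.
have ji : (j <= i.+1)%N.
  rewrite -(ler_nat R); apply: le_trans (ltW j1) (le_trans _ i2).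
  by rewrite ler_wpM2l// V_le.
have ir : i.+1%:R - j%:R <= r by rewrite /r mulrBr; rewrite -!natr1 in j2 *; lra.
have : `|grid_dev i.+1 - grid_dev j| <= w (i.+1%:R - j%:R) by apply: grid_dev_osc; rewrite ji.
have := w_homo ir; rewrite natrB// ler_norml => + /andP[_].
by rewrite -[e.+1%:R]natr1 in i3; lra.
Qed.

End Modulus.

Lemma spacing_gap_cells (G s e : nat) (k : R) : (0 < G)%N ->
  (forall i, (i < G)%N ->
    count_le V 0 n (i.+1%:R / G%:R) - count_le V 0 n (i%:R / G%:R) < k) ->
  (s <= e)%N -> (e < n)%N -> 2 * k <= (e - s)%N%:R -> G%:R^-1 <= V e - V s.
Proof.
move=> G0 sparse se en; rewrite natrB// => es.
have GR : 0 < G%:R :> R by rewrite ltr0n.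
have sn : (s < n)%N by exact: leq_ltn_trans en.
have [i [iG i1 i2]] := mesh_cell G0 (V01 sn).
rewrite leNgt; apply/negP => gap.
have below := ordered_count_le sn i1; have cell_i := sparse i iG.
have eS : e.+1%:R = e%:R + 1 :> R by rewrite natr1.
have [iG'|iG'] := ltnP i.+1 G.
  have := sparse i.+1 iG'; suff : e.+1%:R <= count_le V 0 n (i.+2%:R / G%:R) by lra.
  apply: ordered_count_ge => //; move: i2; rewrite -[i.+2%:R]natr1 mulrDl mul1r; lra.
have iE : i.+1 = G by apply/eqP; rewrite eqn_leq iG iG'.
have k0 : 0 <= k.
  by apply: ltW; apply: le_lt_trans cell_i; rewrite count_le_sub ?ler_natr_div// sumr_ge0.
suff : e.+1%:R <= count_le V 0 n (i.+1%:R / G%:R) by lra.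
by apply: ordered_count_ge => //; rewrite iE divff ?gt_eqF//; case/andP: (V01 en).
Qed.

End OrderedSample.

(** * Kernel averages of spacings and of points *)

Section LipschitzIntegral.
Context {R : realType}.
Local Notation mu := (@lebesgue_measure R).
Variables (f : R -> R) (L : R).
Hypothesis f_lip : forall x y, `|f x - f y| <= L * `|x - y|.

Let L0 : 0 <= L.
Proof. by have := f_lip 1 0; rewrite subr0 normr1 mulr1; exact: le_trans. Qed.

Lemma lipschitz_continuous : continuous f.
Proof.
move=> x; apply/cvgrPdist_lt => e e0; have L1 : 0 < L + 1 by have := L0; lra.
near=> y; apply: le_lt_trans (f_lip _ _) _.
have : `|x - y| < e / (L + 1) by near: y; apply: cvgr_dist_lt => //; rewrite divr_gt0.
by rewrite ltr_pdivlMr//; have := normr_ge0 (x - y); nra.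
Unshelve. all: by end_near. Qed.

Lemma lipschitz_integrable (a b : R) : mu.-integrable `[a, b] (EFin \o f).
Proof.
apply: continuous_compact_integrable; first exact: segment_compact.
by apply: continuous_subspaceT; exact: lipschitz_continuous.
Qed.

Lemma Rintegral_lipschitz_cell (a b : R) : a <= b ->
  `|\int[mu]_(x in `]a, b]) f x - f b * (b - a)| <= L * (b - a) ^+ 2.
Proof.
move=> ab.
have integrable_cc (g : R -> R) : mu.-integrable `[a, b] (EFin \o g) ->
    mu.-integrable `]a, b] (EFin \o g).
  by move=> ig; apply: integrableS ig => //; exact: subset_itv_oc_cc.
have integrable_c c : mu.-integrable `]a, b] (EFin \o cst c).
  apply: integrable_cc; apply: continuous_compact_integrable; first exact: segment_compact.
  by apply: continuous_subspaceT => x; exact: cst_continuous.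
have integral_c c : \int[mu]_(x in `]a, b]) c = c * (b - a).
  rewrite Rintegral_cst//= lebesgue_measure_itv /= lte_fin; congr (_ * _).
  by case: ltP => //= ba; apply/eqP; rewrite eq_sym subr_eq0 eq_le ab ba.
have intf := integrable_cc _ (lipschitz_integrable a b).
rewrite -(integral_c (f b)) -RintegralB//; last exact: integrable_c.
apply: le_trans (le_normr_Rintegral _ _) _ => //.
  exact: (integrableB _ intf (integrable_c _)).
rewrite expr2 mulrA -integral_c; apply: le_Rintegral => //; last 2 first.
- exact: integrable_c.
- move=> x; rewrite /= in_itv/= => /andP[ax xb]; apply: le_trans (f_lip _ _) _.
  by rewrite ler_wpM2l// ler0_norm; lra.
exact: (integrable_norm (integrableB _ intf (integrable_c _))).
Qed.

End LipschitzIntegral.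

Section Averages.
Context {R : realType}.
Implicit Types (V : nat -> R) (g : R -> R) (n : nat).

Definition spacing_avg V n g : R := \sum_(1 <= i < n) g (i%:R / n%:R) * (V i - V i.-1).

Definition density_avg V n g : R := n%:R^-1 * \sum_(0 <= k < n) g (V k).

Definition grid_avg n g : R := n%:R^-1 * \sum_(0 <= j < n) g (j.+1%:R / n%:R).

(* The density average with every point moved to the right end of its cell. *)
Definition cell_avg V n g : R := n%:R^-1 * \sum_(0 <= j < n) g (j.+1%:R / n%:R) *
  (count_le V 0 n (j.+1%:R / n%:R) - count_le V 0 n (j%:R / n%:R)).

Definition lipschitz_bump (u h ell : R) g : Prop :=
  [/\ 0 < h, h <= u <= 1 - h, forall x y, `|g x - g y| <= ell * `|x - y| &
      forall x, h <= `|x - u| -> g x = 0].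

Variables (n : nat) (u h ell : R) (g : R -> R).
Hypothesis n0 : (0 < n)%N.
Hypothesis bump_g : lipschitz_bump u h ell g.

Let nR : 0 < n%:R :> R. Proof. by rewrite ltr0n. Qed.
Let h0 : 0 < h. Proof. by case: bump_g. Qed.
Let g_lip x y : `|g x - g y| <= ell * `|x - y|. Proof. by case: bump_g. Qed.
Let g_supp x : h <= `|x - u| -> g x = 0. Proof. by case: bump_g => _ _ _; exact. Qed.

Lemma bump_slope_ge0 : 0 <= ell.
Proof. by have := g_lip 1 0; rewrite subr0 normr1 mulr1; exact: le_trans. Qed.

Let H := n%:R * h.
Let node j := g (j%:R / n%:R).
Let drop j := node j - node j.+1.

Let node0 : node 0 = 0.
Proof.
have [_ /andP[hu _] _ _] := bump_g; rewrite /node mul0r g_supp// sub0r normrN.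
exact: le_trans (ler_norm _).
Qed.

Let node_n : node n = 0.
Proof.
have [_ /andP[_ hu] _ _] := bump_g; rewrite /node divff ?gt_eqF// g_supp//.
by apply: le_trans (ler_norm _); lra.
Qed.

Let sum_by_parts (x : nat -> R) :
  \sum_(0 <= j < n) node j.+1 * (x j.+1 - x j) = \sum_(0 <= j < n) drop j * x j.
Proof.
apply/eqP; rewrite -subr_eq0 -sumrB; apply/eqP.
rewrite (eq_bigr (fun j => node j.+1 * x j.+1 - node j * x j)); last first.
  by move=> j _; rewrite /drop; ring.
by rewrite (telescope_sumr (fun j => node j * x j))// node0 node_n !mul0r subrr.
Qed.

Let sum_drop_shift (x y : nat -> R) (c : R) : (forall j, x j = y j - c) ->
  \sum_(0 <= j < n) drop j * y j = \sum_(0 <= j < n) drop j * x j.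
Proof.
move=> xy; under [RHS]eq_bigr do rewrite xy mulrBr.
rewrite sumrB -mulr_suml.
have -> : \sum_(0 <= j < n) drop j = 0.
  under eq_bigr do rewrite /drop -opprB.
  by rewrite sumrN telescope_sumr// node0 node_n subrr oppr0.
by rewrite mul0r subr0.
Qed.

Let drop_le j : `|drop j| <= ell / n%:R.
Proof.
by apply: le_trans (g_lip _ _) _; rewrite distrC natrS_div_sub ger0_norm ?invr_ge0.
Qed.

Let node_supp j : node j != 0 -> n%:R * u - H <= j%:R <= n%:R * u + H.
Proof.
apply: contraNT => out; apply/eqP/g_supp; rewrite leNgt; apply: contra out.
rewrite ltr_norml => /andP[j1 j2].
have lo : (u - h) * n%:R <= j%:R by rewrite -ler_pdivlMr//; lra.
have hi : j%:R <= (u + h) * n%:R by rewrite -ler_pdivrMr//; lra.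
by rewrite /H; apply/andP; split; lra.
Qed.

Let drop_supp j : drop j != 0 -> n%:R * u - H - 1 <= j%:R <= n%:R * u + H.
Proof.
move=> dj; have : (node j != 0) || (node j.+1 != 0).
  apply: contraNT dj; rewrite negb_or !negbK /drop => /andP[/eqP -> /eqP ->].
  by rewrite subrr.
by move=> /orP[] /node_supp; rewrite -?natr1 => /andP[? ?]; apply/andP; split; lra.
Qed.

Let cell_vanish j x : ~~ (n%:R * u - H - 1 <= j%:R <= n%:R * u + H) ->
  j%:R / n%:R <= x <= j.+1%:R / n%:R -> g x = 0.
Proof.
move=> out; rewrite ler_pdivrMr// ler_pdivlMr// -natr1 => /andP[jx xj].
apply: g_supp; rewrite leNgt; apply: contra out; rewrite ltr_norml => /andP[p1 p2].
have : (u - h) * n%:R < x * n%:R by rewrite ltr_pM2r//; lra.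
have : x * n%:R < (u + h) * n%:R by rewrite ltr_pM2r//; lra.
by move=> ? ?; rewrite /H; apply/andP; split; lra.
Qed.

Let window_le (f : nat -> R) (c : R) : 0 <= c ->
  (forall j, (j < n)%N -> `|f j| <= ell / n%:R * c) ->
  (forall j, (j < n)%N -> f j != 0 -> n%:R * u - H - 1 <= j%:R <= n%:R * u + H) ->
  `|\sum_(0 <= j < n) f j| <= ell / n%:R * c * (2 * H + 2).
Proof.
move=> c0 fc fw; have H0 : 0 < H by rewrite mulr_gt0.
rewrite (_ : 2 * H + 2 = (n%:R * u + H) - (n%:R * u - H - 1) + 1); last by ring.
by apply: ler_norm_sum_window => //; [lra|rewrite !mulr_ge0 ?bump_slope_ge0// invr_ge0].
Qed.

Let sum_drop_le (x : nat -> R) (c : R) : 0 <= c ->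
  (forall j, (j < n)%N -> drop j != 0 -> `|x j| <= c) ->
  `|n%:R^-1 * \sum_(0 <= j < n) drop j * x j| <= ell / n%:R * (c / n%:R) * (2 * H + 2).
Proof.
move=> c0 xc; rewrite normrM ger0_norm ?invr_ge0//.
rewrite [leRHS](_ : _ = n%:R^-1 * (ell / n%:R * c * (2 * H + 2))); last by ring.
rewrite ler_wpM2l ?invr_ge0//; apply: window_le => // j jn.
  have [->|dj] := eqVneq (drop j) 0.
    by rewrite mul0r normr0 !mulr_ge0 ?bump_slope_ge0// invr_ge0.
  by rewrite normrM; apply: ler_pM => //; exact: xc.
by rewrite mulf_eq0 negb_or => /andP[/drop_supp].
Qed.

Let grid_avgE : grid_avg n g = n%:R^-1 * \sum_(0 <= j < n) drop j * j%:R.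
Proof.
rewrite -(sum_by_parts (fun j => j%:R)) /grid_avg; congr (_ * _).
by apply: eq_bigr => j _; rewrite -natrB// subSnn mulr1.
Qed.

Lemma grid_avg_sub_Rintegral :
  `|grid_avg n g - \int[@lebesgue_measure R]_(x in `[0, 1]) g x| <=
    ell / n%:R * n%:R^-1 * (2 * H + 2).
Proof.
set mu := @lebesgue_measure R; pose pt j : R := j%:R / n%:R.
pose Phi y := \int[mu]_(x in `[0, y]) g x.
have PhiB j : Phi (pt j.+1) - Phi (pt j) = \int[mu]_(x in `]pt j, pt j.+1]) g x.
  rewrite /Phi Rintegral_itvB ?bnd_simp ?divr_ge0 ?ler_natr_div//.
  exact: (lipschitz_integrable g_lip).
have -> : \int[mu]_(x in `[0, 1]) g x = \sum_(0 <= j < n) \int[mu]_(x in `]pt j, pt j.+1]) g x.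
  under eq_bigr do rewrite -PhiB; rewrite telescope_sumr// /Phi /pt divff ?gt_eqF// mul0r.
  by rewrite set_itv1 Rintegral_set1 subr0.
rewrite /grid_avg mulr_sumr -sumrB; apply: window_le; first by rewrite invr_ge0.
  move=> j jn; have := Rintegral_lipschitz_cell g_lip (ler_natr_div n (leqnSn j)).
  by rewrite natrS_div_sub expr2 mulrA distrC [g _ * _]mulrC.
move=> j jn; apply: contraNT => out; apply/eqP.
rewrite (cell_vanish out) ?lexx ?ler_natr_div// mulr0.
rewrite (@eq_Rintegral _ _ _ _ _ (fun=> 0)); last first.
  move=> x; rewrite inE /= in_itv/= => /andP[/ltW jx xj].
  by apply: (cell_vanish out); apply/andP.
by rewrite Rintegral_cst// mul0r subrr.
Qed.

Section WithSample.
Variable V : nat -> R.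
Hypothesis ordV : ordered_sample n V.

Let spacing_avgE : spacing_avg V n g = n%:R^-1 * \sum_(0 <= j < n) drop j * (n%:R * V j).
Proof.
under eq_bigr do rewrite mulrCA; rewrite -mulr_sumr mulKf ?gt_eqF// -sum_by_parts.
rewrite /spacing_avg; move: n0 node_n; rewrite /node; case: (n) => // m _ gm.
by rewrite big_add1 /= [RHS]big_nat_recr//= gm mul0r addr0.
Qed.

Let cell_avgE : cell_avg V n g = n%:R^-1 * \sum_(0 <= j < n) drop j * (grid_dev n V j + j%:R).
Proof.
by rewrite -sum_by_parts; congr (_ * _); apply: eq_bigr => j _; rewrite !(count_le_grid ordV).
Qed.

Variables (Lam : R) (w : R -> R).
Hypothesis w_ge0 : forall x, 0 <= w x.
Hypothesis w_homo : {homo w : x y / x <= y}.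
Hypothesis grid_dev_le : forall j, (j <= n)%N -> `|grid_dev n V j| <= Lam.
Hypothesis grid_dev_osc : forall i j, (i <= j <= n)%N ->
  `|grid_dev n V j - grid_dev n V i| <= w (j%:R - i%:R).

Lemma spacing_cell_avg_cancel :
  `|spacing_avg V n g + cell_avg V n g - 2 * grid_avg n g| <=
    ell / n%:R * ((w (Lam + 2) + 2) / n%:R) * (2 * H + 2).
Proof.
have -> : spacing_avg V n g + cell_avg V n g - 2 * grid_avg n g =
    n%:R^-1 * \sum_(0 <= j < n) drop j * (n%:R * V j - j.+1%:R + grid_dev n V j).
  rewrite spacing_avgE cell_avgE grid_avgE mulrCA -mulrDr -mulrBr mulr_sumr.
  rewrite -big_split -sumrB /=; congr (_ * _).
  rewrite (eq_bigr (fun j => drop j * (n%:R * V j + grid_dev n V j - j%:R))); last first.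
    by move=> j _; ring.
  by apply: (sum_drop_shift (c := 1)) => j; rewrite -natr1; ring.
apply: sum_drop_le; first by rewrite addr_ge0.
by move=> j jn _; exact: bahadur_kiefer.
Qed.

Lemma cell_avg_sub_grid_avg : `|cell_avg V n g - grid_avg n g| <=
  ell / n%:R * (w (H + 2) / n%:R) * (2 * H + 2).
Proof.
have [_ /andP[u0 u1] _ _] := bump_g.
pose i := Num.truncn (n%:R * u).
have nu0 : 0 <= n%:R * u by rewrite mulr_ge0//; have := h0; lra.
have /andP[iu ui] : i%:R <= n%:R * u < i.+1%:R by exact: truncn_itv.
have iN : (i <= n)%N.
  rewrite -(ler_nat R); apply: le_trans iu _; rewrite ler_piMr//.
  by have := h0; lra.
have -> : cell_avg V n g - grid_avg n g =
    n%:R^-1 * \sum_(0 <= j < n) drop j * (grid_dev n V j - grid_dev n V i).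
  rewrite cell_avgE grid_avgE -mulrBr -sumrB; congr (_ * _).
  rewrite (eq_bigr (fun j => drop j * grid_dev n V j)); last by move=> j _; ring.
  exact: sum_drop_shift.
apply: sum_drop_le => // j jn /drop_supp /andP[j1 j2].
apply: (grid_dev_sub w_homo grid_dev_osc) => //; first exact: ltnW.
by rewrite -natr1 in ui; rewrite ler_norml; apply/andP; split; lra.
Qed.

Let in_cell j k : R := (j%:R / n%:R < V k <= j.+1%:R / n%:R)%R%:R.

Let cell_countE j : count_le V 0 n (j.+1%:R / n%:R) - count_le V 0 n (j%:R / n%:R) =
  \sum_(0 <= k < n) in_cell j k.
Proof. by rewrite count_le_sub// ler_natr_div. Qed.

Let sum_in_cell k : (k < n)%N -> \sum_(0 <= j < n) in_cell j k = 1.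
Proof.
move=> kn; have [_ _ V01] := ordV; have /andP[V0 V1] := V01 k kn.
pose below j : R := (V k <= j%:R / n%:R)%R%:R.
rewrite (eq_bigr (fun j => below j.+1 - below j)); last first.
  move=> j _; rewrite /below /in_cell.
  have [Vj|_] := leP (V k) (j%:R / n%:R); last by rewrite subr0.
  by rewrite (le_trans Vj (ler_natr_div n (leqnSn j))) subrr.
by rewrite telescope_sumr// /below divff ?gt_eqF// V1 mul0r leNgt V0 subr0.
Qed.

Let density_sub_cell : density_avg V n g - cell_avg V n g =
  n%:R^-1 * \sum_(0 <= j < n) \sum_(0 <= k < n) in_cell j k * (g (V k) - node j.+1).
Proof.
rewrite /density_avg /cell_avg -mulrBr; congr (_ * _).
rewrite [RHS](eq_bigr (fun j => \sum_(0 <= k < n) in_cell j k * g (V k) -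
    node j.+1 * \sum_(0 <= k < n) in_cell j k)); last first.
  by move=> j _; rewrite mulr_sumr -sumrB; apply: eq_bigr => k _; ring.
rewrite sumrB; congr (_ - _); last by apply: eq_bigr => j _; rewrite cell_countE.
rewrite exchange_big /=; apply: eq_big_nat => k /= kn.
by rewrite -mulr_suml sum_in_cell// mul1r.
Qed.

Let in_cell_term_le j k :
  `|in_cell j k * (g (V k) - node j.+1)| <= ell / n%:R * in_cell j k.
Proof.
rewrite /in_cell; case: (boolP (_ && _)) => [/andP[lo hi]|_]; last by rewrite mul0r mulr0 normr0.
rewrite mul1r mulr1; apply: le_trans (g_lip _ _) _; rewrite ler_wpM2l ?bump_slope_ge0//.
by rewrite distrC ger0_norm ?subr_ge0//; have := natrS_div_sub (R := R) j n; lra.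
Qed.

Lemma density_avg_sub_cell_avg : `|density_avg V n g - cell_avg V n g| <=
  ell / n%:R * ((1 + w 1) / n%:R) * (2 * H + 2).
Proof.
rewrite density_sub_cell normrM ger0_norm ?invr_ge0//.
rewrite [leRHS](_ : _ = n%:R^-1 * (ell / n%:R * (1 + w 1) * (2 * H + 2))); last by ring.
rewrite ler_wpM2l ?invr_ge0//; apply: window_le; first by rewrite addr_ge0.
  move=> j jn; apply: le_trans (ler_norm_sum _ _ _) _.
  apply: (@le_trans _ _ (\sum_(0 <= k < n) ell / n%:R * in_cell j k)).
    by apply: ler_sum => k _; exact: in_cell_term_le.
  rewrite -mulr_sumr ler_wpM2l ?divr_ge0 ?bump_slope_ge0// -cell_countE !(count_le_grid ordV).
  have := grid_dev_osc (i := j) (j := j.+1); rewrite leqnSn jn => /(_ isT).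
  have jS : j.+1%:R - j%:R = 1 :> R by rewrite -natrB// subSnn.
  by rewrite jS ler_norml => /andP[_]; lra.
move=> j jn; apply: contraNT => out; apply/eqP; apply: big1_seq => k _.
rewrite /in_cell; case: (boolP (_ && _)) => [/andP[lo hi]|_]; last by rewrite mul0r.
by rewrite /node !(cell_vanish out) ?(ltW lo) ?hi ?ler_natr_div ?lexx// subrr mulr0.
Qed.

Lemma spacing_avg_ge (m : R) (s e : nat) : (forall x, 0 <= g x) ->
  (s <= e)%N -> (e < n)%N ->
  (forall i, (s < i <= e)%N -> m <= g (i%:R / n%:R)) -> m * (V e - V s) <= spacing_avg V n g.
Proof.
move=> g0 se en gm; have [_ V_le _] := ordV.
have gap i : (i < n)%N -> 0 <= V i - V i.-1 by move=> iN; rewrite subr_ge0 V_le// leq_pred.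
rewrite /spacing_avg (@big_cat_nat _ _ _ e.+1)//= (@big_cat_nat _ _ _ s.+1)//=.
rewrite -addrA addrC -addrA; set inner := \sum_(s.+1 <= i < e.+1) _.
apply: (@le_trans _ _ inner); last first.
  rewrite lerDl addr_ge0// big_nat sumr_ge0// => i /andP[_ i2]; rewrite mulr_ge0// gap//.
  exact: leq_trans i2 (leq_ltn_trans se en).
rewrite -telescope_sumr// mulr_sumr /inner big_add1 /=.
apply: ler_sum_nat => i /andP[si ie]; apply: ler_wpM2r; last by apply: gm; rewrite ltnS si.
by apply: (gap i.+1); exact: leq_ltn_trans en.
Qed.

Lemma spacing_sum_linearize (Q : R -> R) (slope c : R) : (forall x, 0 <= g x) ->
  let eta := h + (Lam + 2) / n%:R in
  (forall x y, 0 <= x -> x <= y -> y <= 1 -> `|x - u| <= eta -> `|y - u| <= eta ->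
     `|Q y - Q x - slope * (y - x)| <= c * (y - x)) ->
  `|spacing_avg V n g * slope - \sum_(1 <= i < n) g (i%:R / n%:R) * (Q (V i) - Q (V i.-1))|
    <= c * spacing_avg V n g.
Proof.
move=> g0 eta Qlin; have [_ V_le V01] := ordV.
rewrite /spacing_avg mulr_suml mulr_sumr -sumrB.
apply: le_trans (ler_norm_sum _ _ _) _; apply: ler_sum_nat => i /andP[i1 iN].
have [->|gi] := eqVneq (g (i%:R / n%:R)) 0; first by rewrite !mul0r mulr0 subrr normr0.
have iN' : (i.-1 < n)%N by exact: leq_ltn_trans (leq_pred _) iN.
rewrite distrC (_ : _ - _ = g (i%:R / n%:R) * (Q (V i) - Q (V i.-1) - slope * (V i - V i.-1)));
  last by ring.
rewrite normrM ger0_norm// mulrCA ler_wpM2l//.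
have iu : `|i%:R / n%:R - u| < h by rewrite ltNge; apply: contra gi => /g_supp ->.
have near_u k : (k < n)%N -> `|k.+1%:R - i%:R| <= 1 :> R -> `|V k - u| <= eta.
  move=> kn ki; have Vk := quantile_dev ordV grid_dev_le kn.
  have -> : V k - u = (n%:R * V k - k.+1%:R) / n%:R + (k.+1%:R - i%:R) / n%:R +
    (i%:R / n%:R - u) by field; rewrite gt_eqF.
  apply: le_trans (ler_normD _ _) _; rewrite /eta addrC lerD ?(ltW iu)//.
  rewrite -mulrDl normrM [`|n%:R^-1|]ger0_norm ?invr_ge0// ler_wpM2r ?invr_ge0//.
  by apply: le_trans (ler_normD _ _) _; lra.
have /andP[/ltW V0 _] := V01 _ iN'; have /andP[_ V1] := V01 _ iN.
apply: Qlin => //; first by apply: V_le; rewrite ?leq_pred.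
  by apply: near_u => //; rewrite prednK// subrr normr0.
by apply: near_u => //; rewrite -natr1 addrAC subrr add0r normr1.
Qed.

End WithSample.
End Averages.

Section Kernel.
Context {R : realType}.
Local Notation mu := (@lebesgue_measure R).

Definition lipschitz_kernel (K : R -> R) (L : R) : Prop :=
  [/\ forall x, 0 <= K x, (\int[mu]_x (K x)%:E = 1)%E,
      forall x y, `|K x - K y| <= L * `|x - y| & forall x, 1 < `|x| -> K x = 0].

Variables (K : R -> R) (L : R).
Hypothesis kerK : lipschitz_kernel K L.

Let K0 x : 0 <= K x. Proof. by case: kerK. Qed.
Let K1 : (\int[mu]_x (K x)%:E = 1)%E. Proof. by case: kerK. Qed.
Let K_lip x y : `|K x - K y| <= L * `|x - y|. Proof. by case: kerK. Qed.

Lemma kernel_slope_ge0 : 0 <= L.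
Proof. by have := K_lip 1 0; rewrite subr0 normr1 mulr1; exact: le_trans. Qed.

Lemma kernel_supp (x : R) : 1 <= `|x| -> K x = 0.
Proof.
have [_ _ _ K_supp] := kerK; have L0 := kernel_slope_ge0.
rewrite le_eqVlt => /predU1P[x1|]; last exact: K_supp.
apply/eqP; rewrite -normr_le0; apply/ler_addgt0Pr => /= e e0; rewrite add0r.
pose y := x * (1 + e / (L + 1)).
have eL : 0 < e / (L + 1) by rewrite divr_gt0//; lra.
have Ky : K y = 0.
  by apply: K_supp; rewrite normrM -x1 mul1r ger0_norm ?ltrDl ?addr_ge0 ?(ltW eL).
rewrite -[K x]subr0 -{1}Ky; apply: le_trans (K_lip _ _) _.
rewrite (_ : x - y = - (x * (e / (L + 1)))); last by rewrite /y; ring.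
rewrite normrN normrM -x1 mul1r ger0_norm ?(ltW eL)//.
by rewrite mulrA ler_pdivrMr ?(mulrC e) ?ler_pM2r//; lra.
Qed.

Lemma kernel_bounded_below : exists z r kappa : R,
  [/\ 0 < r, 0 < kappa, -1 < z - r, z + r < 1 & forall x, z - r <= x <= z + r -> kappa <= K x].
Proof.
have L0 := kernel_slope_ge0.
have [z Kz] : exists z, 0 < K z.
  apply: contrapT => /forallNP nK; move: K1.
  rewrite (_ : (fun x => (K x)%:E) = cst 0%E).
    by rewrite integral_cst// mul0e => /eqP; rewrite eq_sym onee_eq0.
  apply/funext => x /=; congr EFin; apply/eqP; rewrite eq_le K0 andbT leNgt.
  exact/negP/nK.
pose r := K z / (2 * L + 2).
have r0 : 0 < r by rewrite divr_gt0//; lra.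
have rE : (2 * L + 2) * r = K z by rewrite /r mulrC divfK// gt_eqF//; lra.
have half x : z - r <= x <= z + r -> K z / 2 <= K x.
  move=> /andP[x1 x2]; have := K_lip z x; rewrite ler_norml => /andP[_ Kzx].
  have : `|z - x| <= r by rewrite ler_norml; apply/andP; split; lra.
  by move=> /(ler_wpM2l L0); lra.
have inside x : z - r <= x <= z + r -> -1 < x < 1.
  move=> /half Kx; rewrite -ltr_norml ltNge; apply/negP => /kernel_supp E.
  by move: Kx; rewrite E; lra.
exists z, r, (K z / 2); split => //; first by rewrite divr_gt0.
  by have /andP[] : -1 < z - r < 1 by apply: inside; apply/andP; split; lra.
by have /andP[] : -1 < z + r < 1 by apply: inside; apply/andP; split; lra.
Qed.

Section Scaled.
Variables (h u : R).
Hypothesis h0 : 0 < h.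
Hypothesis hu : h <= u <= 1 - h.

Lemma Kh_ge0 x : 0 <= Kh K h x.
Proof. by rewrite mulr_ge0// invr_ge0 ltW. Qed.

Lemma Kh_lipschitz_bump : lipschitz_bump u h (L / h ^+ 2) (fun x => Kh K h (u - x)).
Proof.
have ih : `|h^-1| = h^-1 by rewrite ger0_norm// invr_ge0 ltW.
split=> // [x y|x hx]; last first.
  by rewrite /Kh kernel_supp ?mulr0// normrM distrC ih ler_pdivlMr// mul1r.
rewrite /Kh -mulrBr normrM ih; apply: le_trans (ler_wpM2l _ (K_lip _ _)) _.
  by rewrite invr_ge0 ltW.
rewrite -mulrBl (_ : u - x - (u - y) = y - x); last by ring.
rewrite normrM distrC ih le_eqVlt; apply/orP; left; apply/eqP.
by field; rewrite gt_eqF.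
Qed.

Lemma Rintegral_Kh : \int[mu]_(x in `[0, 1]) Kh K h (u - x) = 1.
Proof.
have /andP[u0 u1] := hu; pose F x : R := (u - x) / h.
have dF (x : R) : is_derive x 1 F (- h^-1).
  by apply: is_derive_eq; rewrite /GRing.scale /=; ring.
have dFE : derive1 F = cst (- h^-1).
  by apply/funext => x; rewrite derive1E; exact: derive_val.
have cF : continuous F.
  by move=> x; apply/differentiable_continuous/derivable1_diffP; exact: ex_derive.
have F_decr : {in `[0, 1] &, {homo F : x y /~ (x < y)%R}}.
  by move=> x y _ _ xy; rewrite ltr_pM2r ?invr_gt0// ltrD2l ltrN2.
have oocF : derivable_oo_LRcontinuous F 0 1.
  split => [x _||]; first exact: ex_derive.
    by apply: cvg_at_right_filter; exact: cF.
  by apply: cvg_at_left_filter; exact: cF.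
have cK : {within `[F 1, F 0], continuous K}.
  by apply: continuous_subspaceT; exact: (lipschitz_continuous K_lip).
have := integration_by_substitution_decreasing ler01 F_decr _ _ _ oocF cK.
rewrite dFE => /(_ _ _ _) subst.
rewrite /Rintegral (_ : (fun x => (Kh K h (u - x))%:E) =
    (fun x => (((K \o F) * - cst (- h^-1)) x)%:E)); last first.
  by apply/funext => x; rewrite !fctE opprK mulrC.
rewrite -subst; last 3 first.
- by move=> x _; exact: cst_continuous.
- exact: is_cvg_cst.
- exact: is_cvg_cst.
rewrite (_ : integral _ _ _ = 1%E)//.
rewrite -K1 integral_mkcond; apply: eq_integral => x _; rewrite patchE.
case: ifPn => //; rewrite notin_setE /= in_itv/= => /negP; rewrite negb_and -!ltNge => out.
have F1 : F 1 <= -1 by rewrite /F ler_pdivrMr// mulN1r; lra.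
have F0 : 1 <= F 0 by rewrite /F subr0 ler_pdivlMr// mul1r.
rewrite kernel_supp//; case/orP: out => [xF|Fx]; last by apply: le_trans (ler_norm _); lra.
by rewrite -normrN; apply: le_trans (ler_norm _); lra.
Qed.

End Scaled.
End Kernel.

Section CdfDetermines.
Context {R : realType}.
Implicit Types m : probability (measurableTypeR R) R.

Lemma eq_probability_cdf m1 m2 : (forall x, m1 `]-oo, x]%classic = m2 `]-oo, x]%classic) ->
  forall A, measurable A -> m1 A = m2 A.
Proof.
move=> m12 A mA; pose ray k : set R := `]- k%:R, +oo[%classic.
apply: (@g_sigma_algebra_measure_unique _ R (measurableTypeR R) (@RGenOInfty.G R) _ ray).
- by move=> _ [x ->].
- by move=> k; exists (- k%:R).
- apply/seteqP; split => // x _; exists (Num.truncn `|x|).+1 => //=.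
  rewrite /ray/= in_itv/= andbT ltrNl; apply: le_lt_trans (truncnS_gt _).
  by rewrite -normrN ler_norm.
- move=> _ _ [x ->] [y ->]; exists (Num.max x y); apply/seteqP.
  by split=> z /=; rewrite !in_itv/= !andbT gt_max; [move=> [-> ->]|move=> /andP].
- move=> _ [x ->]; rewrite -setCitvl.
  have mx : measurable (`]-oo, x]%classic : set (measurableTypeR R)) by exact: measurable_itv.
  apply: etrans (probability_setC m1 mx) _; rewrite m12.
  exact/esym/(probability_setC m2 mx).
- by move=> k; apply: le_lt_trans (probability_le1 m1 _) (ltry _); exact: measurable_itv.
- by move: mA; rewrite RGenOInfty.measurableE.
Qed.

Lemma cdf_of_unit_interval m : (forall u, 0 <= u <= 1 -> m `]-oo, u]%classic = u%:E) ->
  forall x, m `]-oo, x]%classic = (Num.max 0 (Num.min x 1))%:E.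
Proof.
move=> m01 x; have m_le y z : y <= z -> (m `]-oo, y]%classic <= m `]-oo, z]%classic)%E.
  by move=> yz; apply: le_measure; rewrite ?inE//; exact: subset_itvl.
have [x0|x0] := ltP x 0.
  rewrite min_l ?max_l ?(ltW x0)//; last by apply: le_trans (ltW x0) _.
  apply/eqP; rewrite eq_le measure_ge0 andbT -(m01 0) ?lexx ?ler01//.
  exact/m_le/ltW.
have [x1|x1] := leP x 1; first by rewrite max_r// m01// x0.
rewrite max_r//; apply/eqP; rewrite eq_le probability_le1//=.
by rewrite -(m01 1) ?lexx ?ler01//; exact/m_le/ltW.
Qed.

Lemma uniform_prob_itv (u : R) : 0 <= u <= 1 ->
  uniform_prob (@ltr01 R) `]-oo, u]%classic = u%:E.
Proof.
move=> /andP[u0 u1]; rewrite /uniform_prob integral_uniform_pdf.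
have -> : `]-oo, u]%classic `&` `[0, 1]%classic = `[0, u]%classic :> set R.
  apply/seteqP; split => x /=; rewrite !in_itv/=; first by move=> [-> /andP[->]].
  by move=> /andP[x0 xu]; rewrite x0 (le_trans xu u1).
rewrite (eq_integral (cst 1%E)).
  rewrite integral_cst//= lebesgue_measure_itv/= lte_fin mul1e.
  by case: ltP => [_|u0']; [rewrite oppr0 adde0|congr EFin; apply/eqP; rewrite eq_le u0 u0'].
move=> x; rewrite inE/= in_itv/= => /andP[x0 xu].
by rewrite /uniform_pdf x0 (le_trans xu u1) subr0 invr1.
Qed.

End CdfDetermines.

Section UniformExpectation.
Context {d} {T : measurableType d} {R : realType} (P : probability T R).
Variable U : nat -> T -> R.
Hypothesis unifU : uniform_sample P U.

Lemma uniform_expectation (f : R -> R) i : measurable_fun setT f -> (forall x, 0 <= f x) ->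
  \int[P]_t f (U i t) = \int[@lebesgue_measure R]_(x in `[0, 1]) f x.
Proof.
move=> mf f0; have [mU _ cdfU] := unifU.
pose X : {RV P >-> measurableTypeR R} :=
  @mfun_Sub _ _ T (measurableTypeR R) (U i) (mem_set (mU i)).
have f0E x : (0 <= (f x)%:E)%E by rewrite lee_fin.
have mfE : measurable_fun setT (fun x => (f x)%:E) by exact/measurable_EFinP.
have := integral_uniform (@ltr01 R) mfE f0E; rewrite subr0 invr1 mul1e => unif.
rewrite /Rintegral -unif; congr fine.
rewrite -[LHS](@ge0_integral_distribution _ _ _ _ _ _ X (fun x => (f x)%:E) mfE f0E).
apply: (@eq_measure_integral _ _ _ setT (uniform_prob (@ltr01 R)) (distribution P X)).
move=> A mA _; apply: (eq_probability_cdf _ mA) => x.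
by rewrite !cdf_of_unit_interval//; [exact: uniform_prob_itv|exact: cdfU].
Qed.

End UniformExpectation.

(** * The counterfactual functional *)

Section C1Functions.
Context {R : realType}.
Implicit Types (f g df dg : R -> R) (a b : R).

Definition C1_on a b f df : Prop := [/\ {within `[a, b], continuous f},
  forall x, x \in `]a, b[ -> is_derive x 1 f (df x) & {within `[a, b], continuous df}].

Lemma within_continuousM (A : set R) f g : {within A, continuous f} ->
  {within A, continuous g} -> {within A, continuous (fun x => f x * g x)}.
Proof. by move=> cf cg x; apply: continuousM; [exact: cf|exact: cg]. Qed.

Lemma within_continuous_bounded a b f : {within `[a, b], continuous f} ->
  exists2 M : R, 0 < M & forall x, a <= x <= b -> `|f x| <= M.
Proof.
move=> cf; have := continuous_compact cf (segment_compact (a := a) (b := b)).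
move=> /compact_bounded[M [_ bM]]; exists (`|M| + 1) => [|x xab]; first by rewrite ltr_wpDl.
apply: (bM (`|M| + 1)); first by rewrite ltr_pwDr// ler_norm.
by exists x => //=; rewrite in_itv.
Qed.

Lemma C1_onW a b c d f df : a <= c -> d <= b -> C1_on a b f df -> C1_on c d f df.
Proof.
move=> ac db [cf fd cdf]; have sub : `[c, d]%classic `<=` `[a, b]%classic.
  by move=> x /=; rewrite !in_itv/= => /andP[? ?]; apply/andP; split; lra.
split; [exact: continuous_subspaceW cf| |exact: continuous_subspaceW cdf].
by move=> x; rewrite in_itv/= => /andP[? ?]; apply: fd; rewrite in_itv/=; apply/andP; split; lra.
Qed.

Lemma C1_onM a b f df g dg : C1_on a b f df -> C1_on a b g dg ->
  C1_on a b (fun x => f x * g x) (fun x => df x * g x + f x * dg x).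
Proof.
move=> [cf fd cdf] [cg gd cdg]; split; first exact: within_continuousM.
  move=> x xab; apply: (is_derive_eq (is_deriveM (fd x xab) (gd x xab))).
  by rewrite /GRing.scale /=; ring.
by apply: within_continuousD; exact: within_continuousM.
Qed.

Lemma C1_on_derivable_oo a b f df : a < b -> C1_on a b f df ->
  derivable_oo_LRcontinuous f a b /\ {in `]a, b[, derive1 f =1 df}.
Proof.
move=> ab [cf fd _]; have [_ fl fr] := (continuous_within_itvP _ ab).1 cf.
split; first by split => // x /fd D; exact: ex_derive.
by move=> x /fd D; rewrite derive1E; exact: derive_val.
Qed.

Lemma C1_on_MVT a b f df x y : C1_on a b f df -> a <= x -> x <= y -> y <= b ->
  exists2 c, x <= c <= y & f y - f x = df c * (y - x).
Proof.
move=> C1f ax xy yb; have [cf fd _] := C1_onW ax yb C1f.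
by have [c cxy ->] := MVT_segment xy fd cf; exists c => //; move: cxy; rewrite in_itv.
Qed.

Lemma C1_on_lipschitz a b f df (M : R) : C1_on a b f df ->
  (forall x, a <= x <= b -> `|df x| <= M) ->
  forall x y, a <= x <= b -> a <= y <= b -> `|f y - f x| <= M * `|y - x|.
Proof.
move=> C1f dfM; suff lip x y : a <= x -> x <= y -> y <= b -> `|f y - f x| <= M * `|y - x|.
  move=> x y /andP[ax xb] /andP[ay yb]; have [xy|/ltW yx] := leP x y; first exact: lip.
  by rewrite distrC [`|y - x|]distrC; exact: lip.
move=> ax xy yb; have [c /andP[xc cy] ->] := C1_on_MVT C1f ax xy yb.
by rewrite normrM ler_wpM2r// dfM//; apply/andP; split; lra.
Qed.

Lemma C1_on_linearize a b f df (M u eta : R) : C1_on a b f df -> 0 <= M ->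
  (forall x, a <= x <= b -> `|df x - df u| <= M * `|x - u|) ->
  forall x y, a <= x -> x <= y -> y <= b -> `|x - u| <= eta -> `|y - u| <= eta ->
  `|f y - f x - df u * (y - x)| <= M * eta * (y - x).
Proof.
move=> C1f M0 df_lip x y ax xy yb xu yu.
have [c /andP[xc cy] ->] := C1_on_MVT C1f ax xy yb.
rewrite -mulrBl normrM [`|y - x|]ger0_norm ?subr_ge0// ler_wpM2r ?subr_ge0//.
apply: le_trans (df_lip c _) _; first by apply/andP; split; lra.
rewrite ler_wpM2l//; move: xu yu; rewrite !ler_norml => /andP[? ?] /andP[? ?].
by apply/andP; split; lra.
Qed.

End C1Functions.

Section BiddingRatio.
Context {R : realType}.
Variables (M : nat) (p : nat -> R).
Hypothesis A1'_neq0 : forall u : R, u \in `[0, 1] -> A1' M p u != 0.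

Let A1'' (u : R) : R := (deriv (deriv (A1poly M p))).[u].

Definition dAfun (u : R) : R :=
  (A1' M p u * A1' M p u - A1 M p u * A1'' u) * ((A1' M p u)^-1 * (A1' M p u)^-1).

Lemma is_derive_Afun (u : R) : 0 <= u <= 1 -> is_derive u 1 (Afun M p) (dAfun u).
Proof.
move=> u01; have n0 : A1' M p u != 0 by apply: A1'_neq0; rewrite in_itv.
have dA1 : is_derive u 1 (A1 M p) (A1' M p u) by exact: is_derive_poly.
have dA1' : is_derive u 1 (A1' M p) (A1'' u) by exact: is_derive_poly.
apply: (is_derive_eq (is_deriveM dA1 (is_deriveV n0 dA1'))).
by rewrite /dAfun /GRing.scale /=; field.
Qed.

Lemma C1_on_Afun : C1_on 0 1 (Afun M p) dAfun.
Proof.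
have cpoly (r : {poly R}) : {within `[0, 1], continuous (fun x => r.[x])}.
  by apply: continuous_subspaceT => x; exact: continuous_horner.
have cV : {within `[0, 1], continuous (fun x => (A1' M p x)^-1)}.
  apply: continuous_in_subspaceT => x; rewrite inE /= => x01.
  by apply: continuousV; [exact: A1'_neq0|exact: continuous_horner].
split; first by apply: within_continuousM => //; exact: cpoly.
  move=> u; rewrite in_itv/= => /andP[u0 u1].
  by apply: is_derive_Afun; rewrite !ltW.
apply: within_continuousM; last exact: within_continuousM.
by apply: within_continuousB; apply: within_continuousM; exact: cpoly.
Qed.

Lemma chiE (psi dpsi : R -> R) (u : R) : 0 <= u <= 1 ->
  chi M p psi dpsi u = (1 - dAfun u) * psi u - Afun M p u * dpsi u.
Proof.
move=> u01; rewrite /chi derive1E.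
by have D := is_derive_Afun u01; rewrite (@derive_val _ _ _ _ _ _ _ D).
Qed.

Lemma within_continuous_chi (psi dpsi : R -> R) : C1_on 0 1 psi dpsi ->
  {within `[0, 1], continuous (chi M p psi dpsi)}.
Proof.
move=> [cpsi _ cdpsi]; have [cA _ cdA] := C1_on_Afun.
have cchi : {within `[0, 1],
    continuous ((fun u => (cst 1 - dAfun) u * psi u) - (fun u => Afun M p u * dpsi u))}.
  apply: within_continuousB; apply: within_continuousM => //.
  apply: within_continuousB => //.
  by apply: continuous_subspaceT => x; exact: cst_continuous.
apply: subspace_eq_continuous cchi => u; rewrite inE /= in_itv /= => u01.
by rewrite /from_subspace /= chiE.
Qed.

End BiddingRatio.

Section PartsFunctional.
Context {R : realType}.
Local Notation mu := (@lebesgue_measure R).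
Variables (a b : R).
Hypothesis ab : a < b.
Implicit Types (A psi X G : R -> R).

Definition parts_functional X A psi G : R :=
  \int[mu]_(u in `[a, b]) (X u * G u) - A a * psi a * G a + A b * psi b * G b.

Let integrable_within f : {within `[a, b], continuous f} -> mu.-integrable `[a, b] (EFin \o f).
Proof. by move=> cf; apply: continuous_compact_integrable => //; exact: segment_compact. Qed.

Lemma parts_functionalE A dA psi dpsi Q q X :
  C1_on a b A dA -> C1_on a b psi dpsi -> C1_on a b Q q ->
  (forall u, a <= u <= b -> X u = (1 - dA u) * psi u - A u * dpsi u) ->
  \int[mu]_(u in `[a, b]) (psi u * (Q u + A u * q u)) = parts_functional X A psi Q.
Proof.
move=> C1A C1psi C1Q XE; have [cQ _ cq] := C1Q.
have C1f := C1_onM C1psi C1A; set f := fun u => psi u * A u in C1f *.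
set df := fun u => _ in C1f *.
have [cf _ cdf] := C1f; have [cpsi _ _] := C1psi.
have [oof dfE] := C1_on_derivable_oo ab C1f; have [ooQ qE] := C1_on_derivable_oo ab C1Q.
have by_parts := Rintegration_by_parts ab cdf oof dfE cq ooQ qE.
have -> : \int[mu]_(u in `[a, b]) (psi u * (Q u + A u * q u)) =
    \int[mu]_(u in `[a, b]) (psi u * Q u) + \int[mu]_(u in `[a, b]) (f u * q u).
  rewrite -RintegralD//; [|by apply: integrable_within; exact: within_continuousM..].
  by apply: eq_Rintegral => u _; rewrite /f; ring.
rewrite by_parts /parts_functional.
have -> : \int[mu]_(u in `[a, b]) (X u * Q u) =
    \int[mu]_(u in `[a, b]) (psi u * Q u) - \int[mu]_(u in `[a, b]) (df u * Q u).
  rewrite -RintegralB//; [|by apply: integrable_within; exact: within_continuousM..].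
  by apply: eq_Rintegral => u; rewrite inE /= in_itv/= => uab; rewrite XE// /df; ring.
by rewrite /f; ring.
Qed.

Lemma parts_functional_sub_le X A psi (Q Qh : R -> R) (CX CA delta : R) :
  {within `[a, b], continuous X} -> {within `[a, b], continuous Q} ->
  measurable_fun `[a, b] Qh ->
  (forall u, a <= u <= b -> `|X u| <= CX) -> (forall u, a <= u <= b -> `|A u * psi u| <= CA) ->
  (forall u, a <= u <= b -> `|Qh u - Q u| <= delta) ->
  `|parts_functional X A psi Qh - parts_functional X A psi Q| <=
    (CX * (b - a) + 2 * CA) * delta.
Proof.
move=> cX cQ mQh XC AC Qh_dev.
have aab : a <= a <= b by rewrite lexx ltW.
have bab : a <= b <= b by rewrite lexx ltW.
have iQ : mu.-integrable `[a, b] (EFin \o (fun u => X u * Q u)).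
  by apply: integrable_within; exact: within_continuousM.
have iQh : mu.-integrable `[a, b] (EFin \o (fun u => X u * Qh u)).
  apply: measurable_bounded_integrable => //.
  - by rewrite /= lebesgue_measure_itv /= lte_fin ab -EFinB ltry.
  - by apply: measurable_funM => //; exact: subspace_continuous_measurable_fun.
  have [CQ _ QC] := within_continuous_bounded cQ.
  exists (CX * (CQ + delta)); split; first exact: num_real.
  move=> x xM u; rewrite /= in_itv /= => uab; apply: ltW; apply: le_lt_trans xM.
  rewrite normrM; apply: ler_pM => //; first exact: XC.
  rewrite (_ : Qh u = Q u + (Qh u - Q u)); last by ring.
  by apply: le_trans (ler_normD _ _) (lerD (QC _ uab) (Qh_dev _ uab)).
rewrite /parts_functional; set I1 := Rintegral _ _ _; set I2 := Rintegral _ _ _.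
rewrite (_ : _ - _ = (I1 - I2) + (- (A a * psi a * (Qh a - Q a)) +
  A b * psi b * (Qh b - Q b))); last by ring.
rewrite mulrDl; apply: le_trans (ler_normD _ _) (lerD _ _); last first.
  rewrite (_ : 2 * CA * delta = CA * delta + CA * delta); last by ring.
  apply: le_trans (ler_normD _ _) _; rewrite normrN !normrM.
  by apply: lerD; rewrite -normrM; apply: ler_pM => //; (exact: AC || exact: Qh_dev).
rewrite /I1 /I2 -RintegralB//; apply: le_trans (le_normr_Rintegral _ _) _ => //.
  exact: (integrableB _ iQh iQ).
have <- : \int[mu]_(u in `[a, b]) (CX * delta) = CX * (b - a) * delta.
  by rewrite Rintegral_cst//= lebesgue_measure_itv /= lte_fin ab /=; ring.
apply: le_Rintegral => //.
- by have := integrable_norm (integrableB _ iQh iQ); exact.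
- by apply: integrable_within; apply: continuous_subspaceT => x; exact: cst_continuous.
move=> u; rewrite /= in_itv /= => uab; rewrite -mulrBr normrM.
by apply: ler_pM => //; [exact: XC|exact: Qh_dev].
Qed.

End PartsFunctional.

(** * Rates and regimes *)

Section Scales.
Context {R : realType}.
Variable n : nat.
Local Notation lam := (ln n%:R : R).

(* [n^(1/4) ell n], the size of the Bahadur-Kiefer remainder of [n] points. *)
Definition bk_scale : R := Num.sqrt (lil_scale n * lam).

(* The distance of an order statistic from its rank under the law of the iterated logarithm. *)
Definition quantile_radius : R := (400 * lil_scale n + 2) / n%:R.

Definition log_large : Prop := 1 <= ln lam /\ lam ^+ 2 <= root8 n.

Hypothesis large_n : log_large.

Let llog1 : 1 <= ln lam. Proof. by case: large_n. Qed.

Lemma log_ge2 : 2 <= lam.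
Proof.
have l0 : 0 < lam.
  by rewrite ltNge; apply/negP => l0; have := ln_le0 (le_trans l0 ler01); have := llog1; lra.
by have := expR_ge1Dx (ln lam); rewrite lnK ?posrE//; have := llog1; lra.
Qed.

Lemma root8_ge4 : 4 <= root8 n :> R.
Proof. by have [_ lr] := large_n; have := log_ge2; nra. Qed.

Lemma log_large_gt0 : 0 < n%:R :> R.
Proof. by rewrite -root8X8 exprn_gt0//; have := root8_ge4; lra. Qed.

Lemma lil_scale_ge0 : 0 <= lil_scale n :> R.
Proof. exact: sqrtr_ge0. Qed.

Lemma lil_scale_sqr : lil_scale n ^+ 2 = n%:R * ln lam.
Proof. by rewrite sqr_sqrtr// mulr_ge0//; have := llog1; lra. Qed.

Lemma root8X4_le_lil_scale : root8 n ^+ 4 <= lil_scale n :> R.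
Proof.
rewrite -(@ler_pXn2r _ 2)// ?nnegrE ?exprn_ge0 ?root8_ge0 ?lil_scale_ge0//.
by rewrite lil_scale_sqr -exprM root8X8 ler_peMr.
Qed.

Lemma log_le_lil_scale : 2 + 2 * lam <= lil_scale n.
Proof.
have [_ lx] := large_n; have x4 := root8_ge4; have l2 := log_ge2.
apply: le_trans root8X4_le_lil_scale; move: lam (root8 n) lx x4 l2 => l x lx x4 l2.
have : x ^+ 2 <= x ^+ 4 by apply: ler_weXn2l => //; lra.
by have : 4 * x <= x ^+ 2; nra.
Qed.

Lemma bk_scale_ge0 : 0 <= bk_scale.
Proof. exact: sqrtr_ge0. Qed.

Lemma bk_scale_sqr : bk_scale ^+ 2 = lil_scale n * lam.
Proof. by rewrite sqr_sqrtr// mulr_ge0 ?lil_scale_ge0//; have := log_ge2; lra. Qed.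

Lemma log_le_bk_scale : lam <= bk_scale.
Proof.
have := log_ge2; have := log_le_lil_scale => l1 l2.
rewrite -(@ler_pXn2r _ 2)// ?nnegrE ?bk_scale_ge0//; last lra.
by rewrite bk_scale_sqr; nra.
Qed.

Lemma root8X2_le_bk_scale : root8 n ^+ 2 <= bk_scale.
Proof.
rewrite -(@ler_pXn2r _ 2)// ?nnegrE ?bk_scale_ge0 ?exprn_ge0 ?root8_ge0//.
rewrite bk_scale_sqr -exprM; apply: le_trans root8X4_le_lil_scale _.
by rewrite ler_peMr ?lil_scale_ge0//; have := log_ge2; lra.
Qed.

Lemma osc_bound_lil_le : osc_bound lam (400 * lil_scale n + 2) <= 114 * bk_scale.
Proof.
have := log_ge2; have := log_le_lil_scale => l1 l2.
rewrite -(@ler_pXn2r _ 2)// ?nnegrE ?mulr_ge0 ?bk_scale_ge0 ?osc_bound_ge0//.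
rewrite osc_bound_sqr; [|lra|have := lil_scale_ge0; lra].
by rewrite exprMn bk_scale_sqr; nra.
Qed.

Lemma quantile_radius_ge0 : 0 <= quantile_radius.
Proof. by rewrite divr_ge0//; have := lil_scale_ge0; lra. Qed.

Lemma quantile_radius_le_root8 : quantile_radius <= 401 / root8 n.
Proof.
have x4 := root8_ge4; have n0 := log_large_gt0; have l2 := log_ge2; have [_ lx] := large_n.
have ll : ln lam <= lam by apply/ltW/ln_sublinear; lra.
have sx : lil_scale n * root8 n <= n%:R :> R.
  rewrite -(@ler_pXn2r _ 2)// ?nnegrE ?mulr_ge0 ?lil_scale_ge0 ?root8_ge0//.
  rewrite exprMn lil_scale_sqr expr2 -mulrA ler_pM2l// -[leRHS]root8X8.
  have : root8 n ^+ 3 <= root8 n ^+ 8 :> R by apply: ler_weXn2l => //; lra.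
  apply: le_trans; rewrite (_ : root8 n ^+ 3 = root8 n * root8 n ^+ 2); last by ring.
  rewrite ler_wpM2r ?mulr_ge0 ?root8_ge0//.
  by apply: le_trans lx; apply: (le_trans ll); rewrite ler_eXnr//; lra.
rewrite /quantile_radius ler_pdivrMr// mulrAC ler_pdivlMr; last lra.
by have := log_le_lil_scale; nra.
Qed.

Lemma quantile_radius_le_rate (h : R) : 0 < h ->
  quantile_radius <= 401 * (h + bk_scale / (n%:R * h)).
Proof.
move=> h0; have n0 := log_large_gt0; have l2 := log_ge2.
have ll : ln lam <= lam by apply/ltW/ln_sublinear; lra.
have lil_h : lil_scale n / n%:R <= h + bk_scale / (n%:R * h).
  have y0 : 0 <= bk_scale / (n%:R * h) by rewrite divr_ge0 ?bk_scale_ge0// mulr_ge0// ltW.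
  rewrite -(@ler_pXn2r _ 2)// ?nnegrE ?divr_ge0 ?lil_scale_ge0 ?addr_ge0 ?(ltW h0)//.
  apply: (@le_trans _ _ (4 * (h * (bk_scale / (n%:R * h))))).
    rewrite exprMn lil_scale_sqr -subr_ge0.
    have -> : 4 * (h * (bk_scale / (n%:R * h))) - n%:R * ln lam * n%:R^-1 ^+ 2 =
      (4 * bk_scale - ln lam) / n%:R by field; rewrite !gt_eqF.
    by rewrite divr_ge0//; have := log_le_bk_scale; lra.
  move: (bk_scale / _) y0 => y y0; rewrite -subr_ge0 (_ : _ - _ = (h - y) ^+ 2) ?sqr_ge0//.
  by ring.
apply: (@le_trans _ _ (401 * (lil_scale n / n%:R))); last by lra.
by rewrite mulrA /quantile_radius ler_pM2r ?invr_gt0//; have := log_le_lil_scale; lra.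
Qed.

Lemma rate_ge (h : R) : 0 < h ->
  Num.sqrt (n%:R * h) * (h + bk_scale / (n%:R * h)) <= rate n h.
Proof.
move=> h0; have n0 := log_large_gt0; have l2 := log_ge2; have l1 := llog1.
have powR14 x : 0 <= x -> powR x (4%:R^-1 : R) = Num.sqrt (Num.sqrt x).
  move=> x0; rewrite -[RHS]powR12_sqrt ?sqrtr_ge0// -powR12_sqrt// -powRrM.
  by congr powR; field.
rewrite /rate /ell !powRN powR14// powR14; last by lra.
rewrite (_ : 3%:R / 2%:R = 1 + 2%:R^-1 :> R); last by field.
rewrite powRD; last by rewrite gt_eqF ?implybT.
rewrite powRr1 ?(ltW h0)// !powR12_sqrt ?(ltW h0)//.
rewrite /bk_scale /lil_scale !sqrtrM ?sqrtr_ge0//.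
set sn := Num.sqrt n%:R; set sh := Num.sqrt h; set qn := Num.sqrt sn.
have sn0 : 0 < sn by rewrite sqrtr_gt0.
have sh0 : 0 < sh by rewrite sqrtr_gt0.
have qn0 : 0 < qn by rewrite sqrtr_gt0.
have nE : n%:R = sn ^+ 2 by rewrite sqr_sqrtr.
have hE : h = sh ^+ 2 by rewrite sqr_sqrtr// ltW.
have snE : sn = qn ^+ 2 by rewrite sqr_sqrtr// ltW.
rewrite {1 2 3}hE nE snE -subr_ge0.
set X := Num.sqrt (Num.sqrt (ln lam)); set Y := Num.sqrt lam.
by rewrite (_ : _ - _ = sh) ?(ltW sh0)//; field; rewrite !gt_eqF.
Qed.

End Scales.

Section EventuallyLogLarge.
Context {R : realType}.

Lemma root8_eventually_ge (C : R) : \forall n \near \oo, C <= root8 n.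
Proof.
near=> n; apply: le_trans (ler_norm _) _.
rewrite -(@ler_pXn2r _ 8)// ?nnegrE ?root8_ge0// root8X8.
by near: n; exact: nbhs_infty_ger.
Unshelve. all: by end_near. Qed.

Lemma ln_sqr_le_root8 n : (32 ^+ 4 : R) <= root8 n -> ln n%:R ^+ 2 <= (root8 n : R).
Proof.
move=> n32; have x0 : 0 < root8 n :> R by apply: lt_le_trans n32; rewrite exprn_gt0.
pose y : R := Num.sqrt (Num.sqrt (root8 n)).
have y0 : 0 < y by rewrite 2!sqrtr_gt0.
have xE : root8 n = y ^+ 4 by rewrite (exprM _ 2 2) sqr_sqrtr ?sqrtr_ge0// sqr_sqrtr// ltW.
have y32 : 32 <= y by rewrite -(@ler_pXn2r _ 4)// ?nnegrE ?(ltW y0)// -xE.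
have -> : ln n%:R = 32 * ln y by rewrite -root8X8 xE -exprM lnXn// mulr_natl.
have l0 : 0 <= ln y by apply: ln_ge0; lra.
have ly : ln y <= y by apply/ltW/ln_sublinear.
rewrite xE (exprM _ 2 2); apply: lerXn2r; rewrite ?nnegrE ?sqr_ge0 ?mulr_ge0//.
by rewrite expr2; apply: ler_pM.
Qed.

Lemma log_large_eventually : \forall n \near \oo, log_large (R := R) n.
Proof.
near=> n; split; last first.
  by apply: ln_sqr_le_root8; near: n; exact: root8_eventually_ge.
have n_ge : expR (expR 1) <= n%:R :> R by near: n; exact: nbhs_infty_ger.
have ln_ge : expR 1 <= ln n%:R :> R.
  by rewrite -[leLHS]expRK ler_ln ?posrE ?expR_gt0// (lt_le_trans _ n_ge)// expR_gt0.
by rewrite -[leLHS]expRK ler_ln ?posrE ?expR_gt0// (lt_le_trans _ ln_ge)// expR_gt0.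
Unshelve. all: by end_near. Qed.

Lemma quantile_radius_eventually_le (e : R) : 0 < e -> \forall n \near \oo, quantile_radius n <= e.
Proof.
move=> e0; near=> n; have large_n : log_large (R := R) n by near: n; exact: log_large_eventually.
apply: le_trans (quantile_radius_le_root8 large_n) _.
rewrite ler_pdivrMr; last by have := root8_ge4 large_n; lra.
by rewrite mulrC -ler_pdivrMr//; near: n; exact: root8_eventually_ge.
Unshelve. all: by end_near. Qed.

End EventuallyLogLarge.

Section SpacingDensityRegimes.
Context {R : realType}.
Implicit Types a low beta W E eta : R.

Definition regime_const a low : R := 5 * a + (a + 1) * (16 * a) + low^-1.

Lemma regime_const_ge0 a low : 0 < a -> 0 < low -> 0 <= regime_const a low.
Proof.
move=> a0 l0; have : 0 <= low^-1 by rewrite invr_ge0 ltW.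
by rewrite /regime_const; nra.
Qed.

Lemma inverse_small_error W E : `|W + E - 2| <= 1 / 4 -> `|E - 1| <= 1 / 4 ->
  1 / 2 <= W /\ `|E - W^-1| <= 3 * `|W + E - 2| + 2 * (E - 1) ^+ 2.
Proof.
move=> sum4 E4; have /andP[E1 E2] : - (1 / 4) <= E - 1 <= 1 / 4 by rewrite -ler_norml.
have /andP[S1 S2] : - (1 / 4) <= W + E - 2 <= 1 / 4 by rewrite -ler_norml.
have W12 : 1 / 2 <= W by lra.
have W0 : 0 < W by lra.
split=> //; have -> : E - W^-1 = (E * (W + E - 2) - (E - 1) ^+ 2) / W by field; rewrite gt_eqF.
rewrite normrM [`|W^-1|]gtr0_norm ?invr_gt0// ler_pdivrMr//.
apply: le_trans (ler_normB _ _) _; rewrite normrM (ger0_norm (sqr_ge0 _)).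
have Enorm : `|E| <= 5 / 4 by rewrite ler_norml; apply/andP; split; lra.
have := ler_wpM2r (normr_ge0 (W + E - 2)) Enorm.
by have := normr_ge0 (W + E - 2); have := sqr_ge0 (E - 1); nra.
Qed.

(* For small [beta] both averages are close to 1 and [E W - 1] is of second order;
   for large [beta] everything is bounded by a multiple of [beta]. *)
Lemma inverse_spacing_regimes a low beta W E : 1 <= a -> 0 < low -> 0 <= beta ->
  `|W + E - 2| <= a * beta -> `|E - 1| <= a * (1 + beta) ->
  (beta <= 1 -> (E - 1) ^+ 2 <= a * beta) -> ((16 * a)^-1 <= beta -> low <= W * beta) ->
  [/\ 0 < W, `|E - W^-1| <= regime_const a low * beta &
      forall eta, 0 <= eta <= 1 -> eta / W <= 2 * eta + regime_const a low * beta].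
Proof.
move=> a1 low0 beta0 sum_le E_le E_sqr W_beta.
have e0 : 0 < (16 * a)^-1 by rewrite invr_gt0; lra.
have abeta : 0 <= a * beta by rewrite mulr_ge0//; lra.
have low_beta : 0 <= low^-1 * beta by rewrite mulr_ge0// invr_ge0 ltW.
have t_beta : 0 <= (a + 1) * (16 * a) * beta by rewrite !mulr_ge0//; lra.
have CE : regime_const a low * beta = 5 * (a * beta) + (a + 1) * (16 * a) * beta + low^-1 * beta.
  by rewrite /regime_const; ring.
rewrite CE; have [small|/ltW large] := leP beta (16 * a)^-1.
  have ab16 : a * beta <= 1 / 16.
    by move: small; rewrite -[leRHS]mul1r ler_pdivlMr; lra.
  have beta1 : beta <= 1 by nra.
  have sqrE := E_sqr beta1.
  have E4 : `|E - 1| <= 1 / 4.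
    by rewrite -(@ler_pXn2r _ 2)// ?nnegrE// real_normK ?num_real//; lra.
  have sum4 : `|W + E - 2| <= 1 / 4 by lra.
  have [W12 EW] := inverse_small_error sum4 E4.
  split; [lra|lra|move=> eta /andP[eta0 _]].
  by rewrite ler_pdivrMr; [nra|lra].
have lowW := W_beta large.
have be_gt0 : 0 < beta by exact: lt_le_trans large.
have W0 : 0 < W by rewrite -(pmulr_lgt0 _ be_gt0); exact: lt_le_trans lowW.
have iW : W^-1 <= low^-1 * beta.
  by rewrite mulrC ler_pdivlMr// mulrC ler_pdivrMr// mulrC.
have iW0 : 0 <= W^-1 by rewrite invr_ge0 ltW.
have ge1 : 1 <= 16 * a * beta by move: large; rewrite -[_^-1]mul1r ler_pdivrMr; lra.
split=> // [|eta /andP[eta0 eta1]]; last first.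
  have : eta / W <= 1 * W^-1 by rewrite ler_wpM2r.
  lra.
rewrite (_ : E - W^-1 = (E - 1) + (1 - W^-1)); last by ring.
apply: le_trans (ler_normD _ _) _.
have : `|1 - W^-1| <= 1 + W^-1 by rewrite ler_norml; apply/andP; split; lra.
have : (a + 1) * 1 <= (a + 1) * (16 * a * beta) by rewrite ler_wpM2l//; lra.
by rewrite mulrA; lra.
Qed.

End SpacingDensityRegimes.

Definition spacing_floor {R : realType} (kappa r eps : R) : R :=
  Num.min (kappa * r * eps / 2) (kappa * r ^+ 2 / 450).

Section RegularSampleAverages.
Context {R : realType}.
Variables (K : R -> R) (L : R) (n : nat) (V : nat -> R).
Hypothesis kerK : lipschitz_kernel K L.
Hypothesis large_n : log_large (R := R) n.
Hypothesis ordV : ordered_sample n V.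
Hypothesis regV : regular_sample V n.

Local Notation lam := (ln n%:R : R).

Let nR : 0 < n%:R :> R. Proof. exact: log_large_gt0. Qed.
Let n0 : (0 < n)%N. Proof. by case: ordV. Qed.
Let L0 : 0 <= L. Proof. exact: kernel_slope_ge0 kerK. Qed.
Let lam2 : 2 <= lam. Proof. exact: log_ge2. Qed.
Let lam0 : 0 <= lam. Proof. by have := lam2; lra. Qed.
Let w_homo := osc_bound_homo lam0.
Let w_ge0 := osc_bound_ge0 lam.

Lemma regular_grid_dev_le j : (j <= n)%N -> `|grid_dev n V j| <= 400 * lil_scale n.
Proof. by move=> jn; have [lil _ _] := regV; apply: lil; exact: natr_div_itv01. Qed.

Let grid_dev_osc i j : (i <= j <= n)%N ->
  `|grid_dev n V j - grid_dev n V i| <= osc_bound lam (j%:R - i%:R).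
Proof. by have [_ osc _] := regV; exact: osc. Qed.

Variables (h u : R).
Hypothesis h0 : 0 < h.
Hypothesis hu : h <= u <= 1 - h.
Local Notation H := (n%:R * h).
Hypothesis H1 : 1 <= H.

Let g x := Kh K h (u - x).
Let W := spacing_avg V n g.
Let E := density_avg V n g.
Let beta : R := bk_scale n / H.

Let H0 : 0 < H. Proof. by rewrite mulr_gt0. Qed.
Let bump_g : lipschitz_bump u h (L / h ^+ 2) g. Proof. exact: Kh_lipschitz_bump. Qed.
Let beta0 : 0 <= beta. Proof. by rewrite divr_ge0 ?bk_scale_ge0// ltW. Qed.
Let lam_beta : lam / H <= beta. Proof. by rewrite ler_pM2r ?invr_gt0// log_le_bk_scale. Qed.
Let inv_lam : 1 / H <= lam / H. Proof. by rewrite ler_pM2r ?invr_gt0//; have := lam2; lra. Qed.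

Let bump_error_le (x : R) : 0 <= x ->
  L / h ^+ 2 / n%:R * (x / n%:R) * (2 * H + 2) <= 4 * (L * (x / H)).
Proof.
move=> x0; rewrite -subr_ge0.
have -> : 4 * (L * (x / H)) - L / h ^+ 2 / n%:R * (x / n%:R) * (2 * H + 2) =
  2 * L * x * (H - 1) / H ^+ 2 by field; rewrite !gt_eqF.
by rewrite divr_ge0 ?exprn_ge0 ?(ltW H0)// !mulr_ge0 ?subr_ge0.
Qed.

Let grid_avg_dev : `|grid_avg n g - 1| <= 4 * (L * (1 / H)).
Proof.
rewrite -[X in `|_ - X|](Rintegral_Kh kerK h0 hu).
apply: le_trans (grid_avg_sub_Rintegral n0 bump_g) _.
by have := bump_error_le ler01; rewrite [1 / n%:R]mul1r.
Qed.

Let density_cell_dev : `|E - cell_avg V n g| <= 4 * (L * (11 * (lam / H))).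
Proof.
apply: le_trans (density_avg_sub_cell_avg n0 bump_g ordV w_ge0 grid_dev_osc) _.
apply: le_trans (bump_error_le _) _; first by rewrite addr_ge0.
rewrite !ler_wpM2l// mulrA ler_pM2r ?invr_gt0//.
by have := osc_bound_le_affine lam0 ler01; have := lam2; lra.
Qed.

Let cell_grid_dev : `|cell_avg V n g - grid_avg n g| <= 4 * (L * (osc_bound lam (H + 2) / H)).
Proof.
apply: le_trans (cell_avg_sub_grid_avg n0 bump_g ordV w_ge0 w_homo grid_dev_osc) _.
exact: bump_error_le.
Qed.

Lemma spacing_density_sum_dev : `|W + E - 2| <= 520 * (L * beta).
Proof.
have cancel : `|W + cell_avg V n g - 2 * grid_avg n g| <= 4 * (L * (116 * beta)).
  apply: le_trans (spacing_cell_avg_cancel n0 bump_g ordV w_ge0 w_homo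
    regular_grid_dev_le grid_dev_osc) _.
  apply: le_trans (bump_error_le _) _; first by rewrite addr_ge0.
  rewrite !ler_wpM2l// /beta mulrA ler_pM2r ?invr_gt0//.
  by have := osc_bound_lil_le large_n; have := log_le_bk_scale large_n; have := lam2; lra.
rewrite (_ : W + E - 2 = (W + cell_avg V n g - 2 * grid_avg n g) + (E - cell_avg V n g) +
   2 * (grid_avg n g - 1)); last by ring.
apply: le_trans (ler_normD _ _) _; rewrite normrM (ger0_norm (_ : 0 <= 2))//.
apply: le_trans (lerD (ler_normD _ _) (lexx _)) _.
have := ler_wpM2l L0 lam_beta; have := ler_wpM2l L0 inv_lam; have := mulr_ge0 L0 beta0.
by move: cancel density_cell_dev grid_avg_dev; rewrite (mulrCA L 116) (mulrCA L 11); lra.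
Qed.

Lemma density_avg_dev : `|E - 1| <= 4 * (L * ((12 * lam + osc_bound lam (H + 2)) / H)).
Proof.
rewrite (_ : E - 1 = (E - cell_avg V n g) + (cell_avg V n g - grid_avg n g) +
  (grid_avg n g - 1)); last by ring.
apply: le_trans (ler_normD _ _) _; apply: le_trans (lerD (ler_normD _ _) (lexx _)) _.
rewrite (_ : L * _ = 12 * (L * (lam / H)) + L * (osc_bound lam (H + 2) / H)); last by ring.
have := ler_wpM2l L0 inv_lam.
by move: density_cell_dev cell_grid_dev grid_avg_dev; rewrite (mulrCA L 11); lra.
Qed.

Lemma density_avg_dev_linear : `|E - 1| <= L * (12 + 88 * beta).
Proof.
apply: le_trans density_avg_dev _.
have -> : L * (12 + 88 * beta) = 4 * (L * ((3 * H + 22 * bk_scale n) / H)).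
  by rewrite /beta; field; rewrite !gt_eqF.
rewrite !ler_wpM2l// ler_pM2r ?invr_gt0//.
have H2 : 0 <= H + 2 by have := H1; lra.
have := osc_bound_le_affine lam0 H2.
by have := log_le_bk_scale large_n; have := H1; lra.
Qed.

Lemma density_avg_dev_sqr : beta <= 1 -> (E - 1) ^+ 2 <= 16 * 608 * (L ^+ 2 * beta).
Proof.
rewrite ler_pdivrMr// mul1r => BH; have lB := log_le_bk_scale large_n.
set D := 12 * lam + osc_bound lam (H + 2).
have osc2 : osc_bound lam (H + 2) ^+ 2 = 32 * (H + 2 + 2 * lam) * lam.
  by rewrite osc_bound_sqr//; have := H1; lra.
have sqrD : D ^+ 2 <= 608 * (H * bk_scale n).
  have := sqr_ge0 (12 * lam - osc_bound lam (H + 2)).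
  by rewrite /D; move: (osc_bound lam (H + 2)) osc2 lam2 H1 => o o2 l2 h1; nra.
rewrite -real_normK ?num_real//; apply: (@le_trans _ _ ((4 * (L * (D / H))) ^+ 2)).
  rewrite lerXn2r ?nnegrE ?density_avg_dev// !mulr_ge0 ?invr_ge0 ?(ltW H0)//.
  by rewrite addr_ge0// mulr_ge0.
have -> : (4 * (L * (D / H))) ^+ 2 = 16 * L ^+ 2 / H ^+ 2 * D ^+ 2 by field; rewrite !gt_eqF.
have -> : 16 * 608 * (L ^+ 2 * beta) = 16 * L ^+ 2 / H ^+ 2 * (608 * (H * bk_scale n)).
  by rewrite /beta; field; rewrite !gt_eqF.
by rewrite ler_wpM2l// divr_ge0 ?sqr_ge0// mulr_ge0 ?sqr_ge0.
Qed.

Variables (z r kappa : R).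
Hypothesis r0 : 0 < r.
Hypothesis kappa0 : 0 < kappa.
Hypothesis zr_gt : -1 < z - r.
Hypothesis zr_lt : z + r < 1.
Hypothesis K_ge : forall x, z - r <= x <= z + r -> kappa <= K x.

Lemma kernel_window_indices : exists s e, [/\ (s <= e)%N, (e < n)%N,
  2 * (r * H) - 1 <= (e - s)%N%:R & forall i, (s < i <= e)%N -> kappa / h <= g (i%:R / n%:R)].
Proof.
have /andP[u0 u1] := hu; move: (h0) (r0) (zr_gt) (zr_lt) => hp rp zl zu.
pose x := u - h * (z + r); pose y := u - h * (z - r).
have x0 : 0 <= x by rewrite /x; nra.
have xy : x <= y by rewrite /x /y; nra.
have y1 : y < 1 by rewrite /y; nra.
have y0 : 0 <= y by lra.
have /andP[sx xs] := truncn_itv (mulr_ge0 (ltW nR) x0).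
have /andP[ey ye] := truncn_itv (mulr_ge0 (ltW nR) y0).
set s := Num.truncn (n%:R * x) in sx xs; set e := Num.truncn (n%:R * y) in ey ye.
have se : (s <= e)%N by apply: le_truncn; rewrite ler_wpM2l.
exists s, e; split=> // [||i /andP[si ie]].
- by rewrite -(ltr_nat R); apply: le_lt_trans ey _; rewrite gtr_pMr.
- have yxE : n%:R * y - n%:R * x = 2 * (r * H) by rewrite /x /y; ring.
  by rewrite natrB//; rewrite -natr1 in ye; lra.
have xi : x <= i%:R / n%:R.
  by rewrite ler_pdivlMr// mulrC (le_trans (ltW xs))// ler_nat.
have iy : i%:R / n%:R <= y by rewrite ler_pdivrMr// mulrC (le_trans _ ey)// ler_nat.
rewrite /g /Kh mulrC ler_pM2l ?invr_gt0//; apply: K_ge.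
by rewrite ler_pdivlMr// ler_pdivrMr//; move: xi iy; rewrite /x /y => *; apply/andP; split; lra.
Qed.

Let g_ge0 x : 0 <= g x. Proof. exact: (Kh_ge0 kerK). Qed.

Lemma spacing_avg_ge_wide : 15 * lam <= r * H -> kappa * r / 2 <= W.
Proof.
move=> wide; have [s [e [se en es gse]]] := kernel_window_indices.
apply: le_trans (spacing_avg_ge ordV g_ge0 se en gse).
have [_ V_le _] := ordV; have Vse := V_le _ _ se en.
have gap := spacing_gap_modulus ordV w_homo grid_dev_osc se en.
have rho0 : 0 <= n%:R * (V e - V s) + 2 by rewrite addr_ge0// mulr_ge0// subr_ge0.
have affine := osc_bound_le_affine lam0 rho0.
rewrite (_ : kappa * r / 2 = kappa / h * (r * H / (2 * n%:R))); last by field; rewrite !gt_eqF.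
rewrite ler_wpM2l ?divr_ge0 ?(ltW kappa0) ?(ltW h0)// ler_pdivrMr ?mulr_gt0//.
by have := lam2; lra.
Qed.

Lemma spacing_avg_ge_narrow : 33 <= r * H -> kappa / (2 * H * root8 n) <= W.
Proof.
move=> rH; have [s [e [se en es gse]]] := kernel_window_indices.
apply: le_trans (spacing_avg_ge ordV g_ge0 se en gse).
have [_ _ cells] := regV; have x4 := root8_ge4 large_n.
have /andP[lo hi] := num_cells_bounds (R := R) n0.
have G0 : 0 < (num_cells R n)%:R :> R by apply: lt_le_trans lo; rewrite mulr_gt0//; lra.
have gap : (num_cells R n)%:R^-1 <= V e - V s.
  by apply: (spacing_gap_cells ordV _ cells se en); [rewrite -(ltr_nat R)|lra].
rewrite (_ : kappa / (2 * H * root8 n) = kappa / h * (2 * (n%:R * root8 n))^-1); last first.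
  by field; rewrite !gt_eqF//; lra.
rewrite ler_wpM2l ?divr_ge0 ?(ltW kappa0) ?(ltW h0)//.
by apply: le_trans gap; rewrite lef_pV2 ?posrE//; apply: lt_le_trans hi.
Qed.

Lemma spacing_avg_bk_lower (eps : R) : 33 <= r * H -> 0 < eps -> eps <= beta ->
  spacing_floor kappa r eps <= W * beta.
Proof.
move=> rH e0 eps_beta; rewrite /spacing_floor ge_min.
have [wide|narrow] := leP (15 * lam) (r * H).
  apply/orP; left; rewrite (_ : kappa * r * eps / 2 = kappa * r / 2 * eps); last by ring.
  apply: ler_pM (ltW e0) (spacing_avg_ge_wide wide) eps_beta.
  by rewrite divr_ge0 ?mulr_ge0// ltW.
apply/orP; right; apply: le_trans (ler_wpM2r beta0 (spacing_avg_ge_narrow rH)).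
have x4 := root8_ge4 large_n; have [_ log_root] := large_n.
rewrite -subr_ge0.
have -> : kappa / (2 * H * root8 n) * beta - kappa * r ^+ 2 / 450 =
    kappa / (2 * root8 n * H ^+ 2) * (bk_scale n - root8 n * ((r * H) ^+ 2 / 225)).
  by rewrite /beta; field; rewrite !gt_eqF//; lra.
apply: mulr_ge0.
  by rewrite divr_ge0 ?(ltW kappa0)// mulr_ge0 ?exprn_ge0 ?(ltW H0)//; lra.
rewrite subr_ge0; apply: le_trans (root8X2_le_bk_scale large_n).
rewrite expr2 ler_wpM2l ?root8_ge0//; apply: le_trans log_root; rewrite ler_pdivrMr//.
have rH0 : 0 <= r * H by lra.
by move: (r * H) narrow rH0 lam2 => y; nra.
Qed.

End RegularSampleAverages.

Section InverseSpacing.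
Context {R : realType}.
Variables (K : R -> R) (L : R).
Hypothesis kerK : lipschitz_kernel K L.

Lemma inverse_spacing_avg : exists C Hmin : R, 0 <= C /\
  forall n V (h u : R), log_large (R := R) n -> ordered_sample n V -> regular_sample V n ->
    0 < h -> h <= u <= 1 - h -> Hmin <= n%:R * h ->
    let W := spacing_avg V n (fun x => Kh K h (u - x)) in
    let E := density_avg V n (fun x => Kh K h (u - x)) in
    let beta := bk_scale n / (n%:R * h) in
    [/\ 0 < W, `|E - W^-1| <= C * beta &
      forall eta, 0 <= eta <= 1 -> eta / W <= 2 * eta + C * beta].
Proof.
have [z [r [kappa [r0 kappa0 zr_gt zr_lt K_ge]]]] := kernel_bounded_below kerK.
have L0 := kernel_slope_ge0 kerK.
pose a := 10000 * (L + 1) ^+ 2; pose low := spacing_floor kappa r (16 * a)^-1.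
have a1 : 1 <= a by rewrite /a; nra.
have e0 : 0 < (16 * a)^-1 by rewrite invr_gt0; lra.
have low0 : 0 < low.
  by rewrite lt_min; apply/andP; split; rewrite divr_gt0 ?mulr_gt0 ?exprn_gt0.
exists (regime_const a low), (33 / r); split; first by apply: regime_const_ge0 => //; lra.
move=> n V h u large_n ordV regV h0 hu; rewrite ler_pdivrMr// mulrC => rH.
have H1 : 1 <= n%:R * h by have := mulr_ge0 (ler0n R n) (ltW h0); nra.
have beta0 : 0 <= bk_scale n / (n%:R * h) by rewrite divr_ge0 ?bk_scale_ge0//; lra.
have Lbeta := mulr_ge0 L0 beta0.
apply: inverse_spacing_regimes => //.
- apply: le_trans (spacing_density_sum_dev kerK large_n ordV regV h0 hu H1) _.
  by rewrite mulrA ler_wpM2r// /a; nra.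
- apply: le_trans (density_avg_dev_linear kerK large_n ordV regV h0 hu H1) _.
  by rewrite /a; nra.
- move=> beta1; apply: le_trans (density_avg_dev_sqr kerK large_n ordV regV h0 hu H1 beta1) _.
  by rewrite mulrA ler_wpM2r// /a; nra.
- move=> eps_beta; exact: (spacing_avg_bk_lower kerK large_n ordV regV h0 hu
    r0 kappa0 zr_gt zr_lt K_ge rH e0 eps_beta).
Qed.

End InverseSpacing.

(** * Order statistics of the bids *)

Section ProbabilityIntegralTransform.
Context {d} {T : measurableType d} {R : realType} (P : probability T R).
Implicit Types (X : nat -> T -> R) (f : R -> R).

Lemma mutually_independent_comp X f : measurable_fun setT f ->
  mutually_independent P X -> mutually_independent P (fun i t => f (X i t)).
Proof.
move=> mf indX s B us mB; apply: (indX s (fun i => f @^-1` B i) us) => i.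
by rewrite -[X in measurable X]setTI; exact: mf.
Qed.

Variables (b : nat -> T -> R) (F Q : R -> R).
Hypothesis mb : forall i, measurable_fun setT (b i).
Hypothesis cdf_b : forall i x, P (b i @^-1` `]-oo, x]) = (F x)%:E.
Hypothesis FQ : forall u, u \in `[0, 1] -> F (Q u) = u.
Hypothesis cQ : {within `[0, 1], continuous Q}.

Let m_ray i x : measurable (b i @^-1` `]-oo, x]).
Proof. by rewrite -[X in measurable X]setTI; exact: mb. Qed.

Lemma cdf_homo : {homo F : x y / x <= y}.
Proof.
move=> x y xy; rewrite -lee_fin -!(cdf_b 0); apply: le_measure; rewrite ?inE//.
by move=> t; rewrite /= !in_itv/= => /le_trans; exact.
Qed.

Lemma quantile_homo : {in `[0, 1] &, {homo Q : u v / u <= v}}.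
Proof.
move=> u v u01 v01 uv; rewrite leNgt; apply/negP => Qvu.
have : v <= u by rewrite -(FQ u01) -(FQ v01) cdf_homo// ltW.
by move=> vu; move: Qvu; rewrite (_ : v = u) ?ltxx//; apply/eqP; rewrite eq_le vu.
Qed.

Lemma quantile_cdf x : Q 0 <= x <= Q 1 -> Q (F x) = x.
Proof.
move=> /andP[Q0x xQ1].
have [u u01 <-] : exists2 u, u \in `[0, 1]%R & Q u = x.
  by apply: IVT; rewrite ?ler01// ge_min le_max Q0x xQ1 orbT.
by rewrite FQ.
Qed.

Lemma ae_quantile_cdf : {ae P, forall t, forall i, Q (F (b i t)) = b i t}.
Proof.
have null i : P.-negligible (b i @^-1` `]-oo, Q 0] `|` ~` (b i @^-1` `]-oo, Q 1])).
  have Q0 : F (Q 0) = 0 by rewrite FQ// in_itv/= lexx ler01.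
  have Q1 : F (Q 1) = 1 by rewrite FQ// in_itv/= lexx ler01.
  apply: negligibleU; apply/negligibleP => //; first by apply: etrans (cdf_b i _) _; rewrite Q0.
    exact: measurableC.
  by apply: etrans (probability_setC P (m_ray i (Q 1))) _; rewrite cdf_b Q1 subee.
apply: negligibleS (negligible_bigcup null) => t /= /existsNP[i Qb].
exists i => //; apply: contrapT => /not_orP[/= lo hi]; apply: Qb; apply: quantile_cdf.
move: lo hi; rewrite !in_itv/= => /negP; rewrite -ltNge => /ltW -> /contrapT -> //.
Qed.

Lemma uniform_sample_cdf : mutually_independent P b ->
  uniform_sample P (fun i t => F (b i t)).
Proof.
move=> indb; have mF : measurable_fun setT F by exact: nondecreasing_measurable cdf_homo.
split=> [i| |i u u01]; first exact: measurableT_comp.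
  exact: mutually_independent_comp.
have mU x : measurable ((fun t => F (b i t)) @^-1` `]-oo, x]).
  rewrite -[X in measurable X]setTI.
  by apply: (measurableT_comp mF (mb i)) => //; exact: measurable_itv.
apply/eqP; rewrite eq_le; apply/andP; split; last first.
  rewrite -[X in X%:E]FQ ?in_itv// -(cdf_b i); apply: le_measure; rewrite ?inE//.
  by move=> t; rewrite /= !in_itv/= => /cdf_homo; rewrite FQ ?in_itv.
have [u1|u1] := leP 1 u.
  by apply: le_trans (probability_le1 _ _) _; rewrite // lee_fin.
have /andP[u0 _] := u01; apply/lee_addgt0Pr => e e0; pose v := Num.min (u + e) 1.
have uv : u < v by rewrite lt_min u1 ltrDl e0.
have v01 : v \in `[0, 1] by rewrite in_itv/= (le_trans u0 (ltW uv)) ge_min lexx orbT.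
apply: (@le_trans _ _ v%:E); last by rewrite -EFinD lee_fin ge_min lexx.
rewrite -(FQ v01) -(cdf_b i); apply: le_measure; rewrite ?inE//.
move=> t; rewrite /= !in_itv/= => Fbu; rewrite leNgt; apply/negP => /ltW/cdf_homo.
by rewrite FQ// => vF; have := le_lt_trans (le_trans vF Fbu) uv; rewrite ltxx.
Qed.

End ProbabilityIntegralTransform.

Section OrderStatistics.
Context {T : Type} {R : realType}.
Variables (U : nat -> T -> R) (n : nat) (t : T).

Let s := sort <=%R (mkseq (fun i => U i t) n).
Let size_s : size s = n. Proof. by rewrite size_sort size_mkseq. Qed.

Lemma ostat_mem k : (k < n)%N -> exists i, ostat U n t k = U i t.
Proof.
move=> kn; have : ostat U n t k \in s by rewrite mem_nth// size_s.
by rewrite mem_sort => /mapP[i _ ->]; exists i.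
Qed.

Lemma ostat_homo k l : (k <= l)%N -> (l < n)%N -> ostat U n t k <= ostat U n t l.
Proof.
move=> kl ln; apply: (sorted_leq_nth le_trans le_refl) => //; rewrite ?inE ?size_s//.
  exact: sort_le_sorted.
exact: leq_ltn_trans ln.
Qed.

Lemma sum_ostat (f : R -> R) :
  \sum_(0 <= k < n) f (ostat U n t k) = \sum_(0 <= i < n) f (U i t).
Proof.
have -> : \sum_(0 <= i < n) f (U i t) = \sum_(x <- mkseq (fun i => U i t) n) f x.
  by rewrite big_map /index_iota subn0.
rewrite (perm_big s); last by rewrite perm_sym; exact/permPl/perm_sort.
by rewrite [RHS](big_nth 0) size_s.
Qed.

Lemma ostat_comp (b : nat -> T -> R) (Q : R -> R) (D : {pred R}) k :
  {in D &, {homo Q : x y / x <= y}} -> (forall i, U i t \in D) ->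
  (forall i, b i t = Q (U i t)) -> (k < n)%N -> ostat b n t k = Q (ostat U n t k).
Proof.
move=> Q_homo UD bQ kn; rewrite /ostat -/s -(nth_map 0 0) ?size_s//; congr nth.
have -> : mkseq (fun i => b i t) n = map Q (mkseq (fun i => U i t) n).
  by rewrite -map_comp; apply: eq_map => i /=.
apply: (sorted_eq le_trans le_anti); first exact: sort_le_sorted.
  apply: (homo_sorted_in Q_homo _ (sort_le_sorted _)).
  by apply/allP => x; rewrite mem_sort => /mapP[i _ ->]; exact: UD.
by rewrite perm_sort perm_map// perm_sym perm_sort.
Qed.

Lemma ordered_ostat : (0 < n)%N -> (forall i, 0 < U i t <= 1) -> ordered_sample n (ostat U n t).
Proof.
move=> n0 U01; split=> // [|k kn]; first exact: ostat_homo.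
by have [i ->] := ostat_mem kn.
Qed.

Lemma count_le_ostat u : count_le (ostat U n t) 0 n u = count_le (U^~ t) 0 n u.
Proof. exact: (sum_ostat (fun x => (x <= u)%R%:R)). Qed.

Lemma regular_sample_ostat : regular_sample (U^~ t) n -> regular_sample (ostat U n t) n.
Proof.
by rewrite /regular_sample /count_dev /cell_count => -[lil osc cells]; split=> *;
   rewrite !count_le_ostat; [exact: lil|exact: osc|exact: cells].
Qed.

Hypothesis n0 : (0 < n)%N.

Let nR : 0 < n%:R :> R. Proof. by rewrite ltr0n. Qed.

Let rank_lt (x : R) : x < 1 -> (Num.truncn (n%:R * x) < n)%N.
Proof.
move=> x1; have [x0|x0] := leP 0 x; last first.
  suff -> : Num.truncn (n%:R * x) = 0%N by [].
  by apply/eqP; rewrite -leqn0 truncn_le_nat; apply: lt_trans ltr01; rewrite pmulr_rlt0.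
rewrite -(ltr_nat R); have /andP[+ _] := truncn_itv (mulr_ge0 (ltW nR) x0).
by move/le_lt_trans; apply; rewrite gtr_pMr.
Qed.

Lemma Qhat_homo : {homo Qhat U n t : x y / x <= y}.
Proof.
have pn : (n.-1 < n)%N by rewrite prednK.
move=> x y xy; rewrite /Qhat; case: ifPn => [x1|]; case: ifPn => [y1|] //.
- by apply: ostat_homo; rewrite ?rank_lt//; apply: le_truncn; rewrite ler_pM2l.
- by move=> _; apply: ostat_homo => //; rewrite -ltnS prednK// rank_lt.
- by rewrite (le_lt_trans xy y1).
Qed.

Lemma Qhat_rank x : 0 <= x <= 1 -> exists j,
  [/\ (j < n)%N, Qhat U n t x = ostat U n t j & `|j.+1%:R - n%:R * x| <= 1].
Proof.
move=> /andP[x0 x1]; have [x_lt1|x_ge1] := ltP x 1.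
  exists (Num.truncn (n%:R * x)); split; [exact: rank_lt|by rewrite /Qhat x_lt1|].
  have /andP[] := truncn_itv (mulr_ge0 (ltW nR) x0); rewrite -natr1 => lo hi.
  by rewrite ler_norml; apply/andP; split; lra.
have -> : x = 1 by lra.
exists n.-1; split; first by rewrite prednK.
  by rewrite /Qhat ltxx.
by rewrite prednK// mulr1 subrr normr0.
Qed.

End OrderStatistics.

(** * The studentized expansion *)

Lemma ratio_expansion {R : realType} (a q qh W E rem c0 Lq eta Ca Cr X Y : R) :
  0 < W -> 0 < c0 -> c0 <= q -> 0 <= eta -> 0 <= Lq -> 0 <= Cr -> Lq * eta <= c0 / 2 ->
  `|W * q - qh| <= Lq * eta * W -> `|E - W^-1| <= X -> eta / W <= Y ->
  `|a| <= Ca -> `|rem| <= Cr * eta ->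
  `|(a * (qh - q) + rem) / qh + a * (E - 1)| <= Ca * X + (Ca * Lq + Cr) * (2 / c0) * Y.
Proof.
move=> W0 c00 cq eta0 Lq0 Cr0 Lq_small qhW EX etaY aC remC.
have cW : 0 < c0 / 2 * W by rewrite mulr_gt0// divr_gt0.
have qh_ge : c0 / 2 * W <= qh.
  have := ler_wpM2r (ltW W0) Lq_small; have := ler_wpM2r (ltW W0) cq.
  by move: qhW; rewrite ler_norml => /andP[_]; lra.
have qh0 : 0 < qh by exact: lt_le_trans qh_ge.
have -> : (a * (qh - q) + rem) / qh + a * (E - 1) =
    a * (E - W^-1) + (a * ((qh - W * q) / W) + rem) / qh by field; rewrite !gt_eqF.
apply: le_trans (ler_normD _ _) (lerD _ _); first by rewrite normrM ler_pM.
have num_le : `|a * ((qh - W * q) / W) + rem| <= (Ca * Lq + Cr) * eta.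
  rewrite [leRHS]mulrDl -[Ca * Lq * _]mulrA; apply: le_trans (ler_normD _ _) (lerD _ _) => //.
  rewrite normrM ler_pM// normrM distrC [`|W^-1|]gtr0_norm ?invr_gt0//.
  by rewrite ler_pdivrMr.
have C0 : 0 <= Ca * Lq + Cr by rewrite addr_ge0// mulr_ge0// (le_trans _ aC).
have C_c0 : 0 <= (Ca * Lq + Cr) * (2 / c0) by rewrite mulr_ge0// divr_ge0// ltW.
apply: le_trans (ler_wpM2l C_c0 etaY).
have -> : (Ca * Lq + Cr) * (2 / c0) * (eta / W) = (Ca * Lq + Cr) * eta * (c0 / 2 * W)^-1.
  by field; rewrite !gt_eqF.
rewrite normrM [`|qh^-1|]gtr0_norm ?invr_gt0//.
by rewrite ler_pM// ?invr_ge0 ?(ltW qh0)// lef_pV2 ?posrE.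
Qed.

Section CounterfactualSplit.
Context {R : realType} {T : Type}.
Variables (M : nat) (p : nat -> R) (K phi psi dpsi Q q : R -> R) (b : nat -> T -> R).
Hypothesis A1'_neq0 : forall u : R, u \in `[0, 1] -> A1' M p u != 0.
Hypothesis C1psi : C1_on 0 1 psi dpsi.
Hypothesis C1Q : C1_on 0 1 Q q.

Local Notation A := (Afun M p).
Local Notation functional u := (parts_functional u 1 (chi M p psi dpsi) A psi).

Definition plug_in_error n t u : R :=
  phi u * (Qhat b n t u - Q u) + (functional u (Qhat b n t) - functional u Q).

Lemma That_sub_Tcf n h t u : 0 <= u < 1 ->
  That M p K phi psi dpsi b n h t u - Tcf M p Q q phi psi u =
  phi u * A u * (qhat K b n h t u - q u) + plug_in_error n t u.
Proof.
move=> /andP[u0 u1]; rewrite /That /Tcf /vhat /vfun /plug_in_error.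
have -> : functional u Q = \int[lebesgue_measure]_(x in `[u, 1]) (psi x * (Q x + A x * q x)).
  have C1_on_tail f df : C1_on 0 1 f df -> C1_on u 1 f df by exact: C1_onW.
  have C1A := C1_on_Afun A1'_neq0.
  apply/esym/(parts_functionalE u1 (C1_on_tail _ _ C1A) (C1_on_tail _ _ C1psi)
    (C1_on_tail _ _ C1Q)) => x /andP[ux x1].
  by rewrite (chiE A1'_neq0)// x1 (le_trans u0).
by rewrite -[Shat _ _ _ _ _ _ _ _]/(functional u (Qhat b n t)); ring.
Qed.

Hypothesis cphi : {within `[0, 1], continuous phi}.

Lemma plug_in_error_le : exists2 C : R, 0 <= C & forall n t u (delta : R),
  (0 < n)%N -> 0 <= u < 1 -> (forall x, 0 <= x <= 1 -> `|Qhat b n t x - Q x| <= delta) ->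
  `|plug_in_error n t u| <= C * delta.
Proof.
have [cA _ _] := C1_on_Afun A1'_neq0; have [cpsi _ _] := C1psi; have [cQ _ _] := C1Q.
have cchi := within_continuous_chi A1'_neq0 C1psi.
have [Cphi Cphi0 phiC] := within_continuous_bounded cphi.
have [CX CX0 chiC] := within_continuous_bounded cchi.
have [CA CA0 ApsiC] := within_continuous_bounded (within_continuousM cA cpsi).
exists (Cphi + (CX + 2 * CA)); first by rewrite !addr_ge0 ?mulr_ge0 ?ltW.
move=> n t u delta n0 /andP[u0 u1] dev.
have tail x : u <= x <= 1 -> 0 <= x <= 1 by move=> /andP[ux ->]; rewrite (le_trans u0).
have u01 : 0 <= u <= 1 by rewrite u0 ltW.
have delta0 : 0 <= delta by exact: le_trans (dev u u01).
have sub : `[u, 1]%classic `<=` `[0, 1]%classic by move=> x /=; rewrite !in_itv; exact: tail.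
have mQhat : measurable_fun `[u, 1] (Qhat b n t).
  by apply: nondecreasing_measurable => //; exact: Qhat_homo.
rewrite mulrDl; apply: le_trans (ler_normD _ _) (lerD _ _).
  by rewrite normrM ler_pM// ?phiC// dev.
apply: le_trans (parts_functional_sub_le u1 (continuous_subspaceW sub cchi)
  (continuous_subspaceW sub cQ) mQhat (fun x ux => chiC x (tail x ux))
  (fun x ux => ApsiC x (tail x ux)) (fun x ux => dev x (tail x ux))) _.
by rewrite ler_wpM2r// lerD2r ler_piMr ?(ltW CX0)// lerBlDr lerDl.
Qed.

End CounterfactualSplit.

Section PathwiseExpansion.
Context {d} {T : measurableType d} {R : realType} (P : probability T R).
Variables (b : nat -> T -> R) (F Q q q2 K phi psi dpsi : R -> R) (M : nat) (p : nat -> R) (L : R).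

Let U i t := F (b i t).

Hypothesis unifU : uniform_sample P U.
Hypothesis Q_homo : {in `[0, 1] &, {homo Q : u v / u <= v}}.
Hypothesis C1Q : C1_on 0 1 Q q.
Hypothesis C1q : C1_on 0 1 q q2.
Hypothesis q_gt0 : forall u : R, u \in `[0, 1] -> 0 < q u.
Hypothesis A1'_neq0 : forall u : R, u \in `[0, 1] -> A1' M p u != 0.
Hypothesis cphi : {within `[0, 1], continuous phi}.
Hypothesis C1psi : C1_on 0 1 psi dpsi.
Hypothesis kerK : lipschitz_kernel K L.

Local Notation A := (Afun M p).
Local Notation V n t := (ostat U n t).
Local Notation bump h u := (fun x => Kh K h (u - x)).

Local Notation bk_rate n h := (bk_scale n / (n%:R * h)).

Definition typical_path n t : Prop := [/\ log_large (R := R) n, forall i, 0 < U i t <= 1,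
  forall i, Q (U i t) = b i t & regular_sample (U^~ t) n].

Lemma typical_ordered n t : typical_path n t -> ordered_sample n (V n t).
Proof.
by move=> [/log_large_gt0 n0 U01 _ _]; apply: ordered_ostat => //; rewrite -(ltr_nat R).
Qed.

Lemma typical_regular n t : typical_path n t -> regular_sample (V n t) n.
Proof. by move=> [_ _ _ regU]; exact: regular_sample_ostat. Qed.

Lemma typical_ostat n t k : typical_path n t -> (k < n)%N -> ostat b n t k = Q (V n t k).
Proof.
move=> [_ U01 QU _]; apply: ostat_comp Q_homo _ _ => i; last by rewrite QU.
by rewrite in_itv/=; have /andP[/ltW -> ->] := U01 i.
Qed.

Lemma Qhat_dev : exists2 C, 0 <= C & forall n t x, typical_path n t -> 0 <= x <= 1 ->
  `|Qhat b n t x - Q x| <= C * quantile_radius n.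
Proof.
have [_ _ cq] := C1Q; have [C C0 qC] := within_continuous_bounded cq.
exists C => [|n t x typ x01]; first exact: ltW.
have [n0 _ V01] := typical_ordered typ; have nR : 0 < n%:R :> R by rewrite ltr0n.
have [j [jn -> jx]] := Qhat_rank b t n0 x01; rewrite (typical_ostat typ jn).
have /andP[/ltW V0 V1] := V01 j jn.
apply: le_trans (C1_on_lipschitz C1Q qC x01 _) _; first by rewrite V0.
rewrite ler_wpM2l ?(ltW C0)// ler_pdivlMr// -[n%:R]ger0_norm// -normrM.
rewrite (_ : _ * n%:R = (n%:R * V n t j - j.+1%:R) + (j.+1%:R - n%:R * x)); last by ring.
have := quantile_dev (typical_ordered typ) (regular_grid_dev_le (typical_regular typ)) jn.
by have := ler_normD (n%:R * V n t j - j.+1%:R) (j.+1%:R - n%:R * x); lra.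
Qed.

Lemma qhat_linearize : exists2 C, 0 < C & forall n t h u, typical_path n t ->
  0 < h -> h <= u <= 1 - h ->
  let W := spacing_avg (V n t) n (bump h u) in
  `|W * q u - qhat K b n h t u| <= C * (h + quantile_radius n) * W.
Proof.
have [_ _ cq2] := C1q; have [C C0 q2C] := within_continuous_bounded cq2.
exists C => // n t h u typ h0 hu; have ordV := typical_ordered typ.
have [n0 _ _] := ordV; have /andP[u0 u1] := hu.
have -> : qhat K b n h t u =
    \sum_(1 <= i < n) bump h u (i%:R / n%:R) * (Q (V n t i) - Q (V n t i.-1)).
  apply: eq_big_nat => i /andP[i1 iN]; rewrite !(typical_ostat typ)//.
  exact: leq_ltn_trans (leq_pred _) iN.
apply: (spacing_sum_linearize n0 (Kh_lipschitz_bump kerK h0 hu) ordV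
  (regular_grid_dev_le (typical_regular typ))).
  by move=> x; exact: (Kh_ge0 kerK).
apply: (C1_on_linearize C1Q (ltW C0)) => x x01; apply: (C1_on_lipschitz C1q q2C) => //.
by apply/andP; split; lra.
Qed.

Lemma GnhE n t h u : (0 < n)%N -> 0 < h -> h <= u <= 1 - h ->
  Gnh P K F b n h t u = Num.sqrt (n%:R * h) * (density_avg (V n t) n (bump h u) - 1).
Proof.
move=> n0 h0 hu; have nR : 0 < n%:R :> R by rewrite ltr0n.
have mean i : \int[P]_w bump h u (U i w) = 1.
  rewrite -[RHS](Rintegral_Kh kerK h0 hu).
  apply: (uniform_expectation unifU (f := bump h u)) => [|x]; last exact: (Kh_ge0 kerK).
  apply: continuous_measurable_fun.
  by have [_ _ /lipschitz_continuous] := Kh_lipschitz_bump kerK h0 hu.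
rewrite /Gnh; congr (_ * _); under eq_bigr => i _ do rewrite mean.
rewrite sumrB sumr_const card_ord mulrBr -[1 *+ n]mulr_natl mulr1 mulVf ?gt_eqF//.
by rewrite /density_avg (sum_ostat U n t (bump h u)) big_mkord.
Qed.

Lemma bk_error_le n h (Ca CW Cs : R) : log_large (R := R) n -> 0 < h ->
  0 <= Ca -> 0 <= CW -> 0 <= Cs ->
  Ca * (CW * bk_rate n h) + Cs * (2 * (h + quantile_radius n) + CW * bk_rate n h) <=
    (Ca * CW + Cs * (804 + CW)) * (h + bk_rate n h).
Proof.
move=> large_n h0 Ca0 CW0 Cs0; have := quantile_radius_le_rate large_n h0.
have : 0 <= bk_rate n h by rewrite divr_ge0 ?bk_scale_ge0// mulr_ge0// ltW.
move: (bk_rate n h) => beta beta0 radius_le.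
have CWbeta : CW * beta <= CW * (h + beta) by rewrite ler_wpM2l// lerDr ltW.
rewrite [leRHS]mulrDl lerD// -[leRHS]mulrA ler_wpM2l//.
by lra.
Qed.

Lemma studentized_expansion : exists C eps Hmin : R, [/\ 0 <= C, 0 < eps &
  forall n t h u, typical_path n t -> 0 < h -> h <= u <= 1 - h ->
    h + quantile_radius n <= eps -> Hmin <= n%:R * h ->
  `|(That M p K phi psi dpsi b n h t u - Tcf M p Q q phi psi u) / qhat K b n h t u
    + phi u * A u * (density_avg (V n t) n (bump h u) - 1)|
  <= C * (h + bk_rate n h)].
Proof.
have [CW [Hmin [CW0 inverse_spacing]]] := inverse_spacing_avg kerK.
have [Lq Lq0 linearize] := qhat_linearize; have [CQ CQ0 Q_dev] := Qhat_dev.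
have [Crem Crem0 rem_le] := plug_in_error_le b A1'_neq0 C1psi C1Q cphi.
have [cA _ _] := C1_on_Afun A1'_neq0; have [cq _ _] := C1q.
have [Ca Ca0 aC] := within_continuous_bounded (within_continuousM cphi cA).
have [v v01 q_min] := EVT_min ler01 cq; set c0 := q v in q_min.
have c00 : 0 < c0 by exact: q_gt0.
set Cs := (Ca * Lq + Crem * CQ) * (2 / c0).
have Cs0 : 0 <= Cs by rewrite !mulr_ge0 ?addr_ge0 ?mulr_ge0 ?invr_ge0// ltW.
exists (Ca * CW + Cs * (804 + CW)), (Num.min 1 (c0 / (2 * Lq))), Hmin; split.
- by apply: addr_ge0; apply: mulr_ge0; rewrite ?addr_ge0// ltW.
- by rewrite lt_min ltr01 divr_gt0// mulr_gt0.
move=> n t h u typ h0 hu; rewrite le_min ler_pdivlMr ?mulr_gt0//.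
set eta := h + _ => /andP[eta1 eta_Lq] H_ge; have /andP[u0 u1] := hu.
have [large_n _ _ _] := typ; have ordV := typical_ordered typ; have [n0 _ _] := ordV.
have rad0 := quantile_radius_ge0 n : 0 <= _ :> R.
have eta0 : 0 <= eta by rewrite addr_ge0// ltW.
have [W0 EW etaW] := inverse_spacing _ _ _ _ large_n ordV (typical_regular typ) h0 hu H_ge.
have u01 : 0 <= u < 1 by apply/andP; split; lra.
have u_in : u \in `[0, 1]%R by rewrite in_itv/=; apply/andP; split; lra.
rewrite (That_sub_Tcf K phi b A1'_neq0 C1psi C1Q)//.
have rem_eta : `|plug_in_error M p phi psi dpsi Q b n t u| <= Crem * CQ * eta.
  apply: le_trans (rem_le _ _ _ _ n0 u01 (fun x => Q_dev n t x typ)) _.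
  by rewrite mulrA ler_wpM2l ?mulr_ge0// lerDr ltW.
apply: le_trans (ratio_expansion W0 c00 (q_min u u_in) eta0 (ltW Lq0) _ _
  (linearize _ _ _ _ typ h0 hu) EW (etaW eta _) (aC u u_in) rem_eta) _.
- by rewrite mulr_ge0.
- by lra.
- by rewrite eta0.
by apply: bk_error_le => //; exact: ltW.
Qed.

Lemma studentized_rate : exists C eps Hmin : R, 0 < eps /\
  forall n t h u, typical_path n t -> 0 < h -> h <= u <= 1 - h ->
    h + quantile_radius n <= eps -> Hmin <= n%:R * h ->
  `|Num.sqrt (n%:R * h) * (That M p K phi psi dpsi b n h t u - Tcf M p Q q phi psi u)
      / qhat K b n h t u - - (phi u * A u * Gnh P K F b n h t u)| <= C * rate n h.
Proof.
have [C [eps [Hmin [C0 eps0 expansion]]]] := studentized_expansion.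
exists C, eps, Hmin; split=> // n t h u typ h0 hu h_le H_ge.
have [n0 _ _] := typical_ordered typ; have [large_n _ _ _] := typ.
rewrite GnhE// (_ : _ - _ = Num.sqrt (n%:R * h) *
  ((That M p K phi psi dpsi b n h t u - Tcf M p Q q phi psi u) / qhat K b n h t u +
   phi u * A u * (density_avg (V n t) n (bump h u) - 1))); last by ring.
rewrite normrM ger0_norm ?sqrtr_ge0//.
apply: le_trans (ler_wpM2l (sqrtr_ge0 _) (expansion _ _ _ _ typ h0 hu h_le H_ge)) _.
by rewrite mulrCA ler_wpM2l// rate_ge.
Qed.

End PathwiseExpansion.

Unset Implicit Arguments.

Theorem mainTheorem7 (R : realType) (d : measure_display) (T : measurableType d)
  (P : probability T R) (b : nat -> T -> R)
  (F Q q q2 : R -> R) (M : nat) (p : nat -> R) (K : R -> R)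
  (phi dphi psi dpsi : R -> R) (h : nat -> R)
  (* standing assumption: b_1, b_2, ... i.i.d. with continuous CDF F *)
  (hbmeas : forall i, measurable_fun setT (b i))
  (hind : mutually_independent P b)
  (hF : forall i x, P (b i @^-1` `]-oo, x]) = (F x)%:E)
  (hFc : continuous F)
  (* Q = F^{-1} on [0,1], twice continuously differentiable, q = Q' > 0 *)
  (hFQ : forall u : R, u \in `[0, 1] -> F (Q u) = u)
  (hQc : {within `[0, 1], continuous Q})
  (hQd : forall u : R, u \in `]0, 1[ -> is_derive u 1 Q (q u))
  (hqc : {within `[0, 1], continuous q})
  (hqd : forall u : R, u \in `]0, 1[ -> is_derive u 1 q (q2 u))
  (hq2c : {within `[0, 1], continuous q2})
  (hqpos : forall u : R, u \in `[0, 1] -> 0 < q u)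
  (* p_1, ..., p_M nonnegative, A_1' <> 0 on [0,1] *)
  (hp : forall m, (1 <= m <= M)%N -> 0 <= p m)
  (hA1' : forall u : R, u \in `[0, 1] -> A1' M p u != 0)
  (* phi, psi continuously differentiable on [0,1] *)
  (hphic : {within `[0, 1], continuous phi})
  (hphid : forall u : R, u \in `]0, 1[ -> is_derive u 1 phi (dphi u))
  (hdphic : {within `[0, 1], continuous dphi})
  (hpsic : {within `[0, 1], continuous psi})
  (hpsid : forall u : R, u \in `]0, 1[ -> is_derive u 1 psi (dpsi u))
  (hdpsic : {within `[0, 1], continuous dpsi})
  (* Assumption 2 on the kernel K *)
  (hK0 : forall x : R, 0 <= K x)
  (hK1 : (\int[lebesgue_measure]_x (K x)%:E = 1)%E)
  (hK2 : (\int[lebesgue_measure]_x ((K x) ^+ 2)%:E < +oo)%E)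
  (hKlip : exists L : R, forall x y, `|K x - K y| <= L * `|x - y|)
  (hKsupp : forall x : R, 1 < `|x| -> K x = 0)
  (* bandwidth *)
  (hpos : forall n, 0 < h n)
  (hh0 : h @ \oo --> 0)
  (hnh : (fun n => n%:R * h n) @ \oo --> +oo) :
  {ae P, forall t, exists C : R, \forall n \near \oo,
     forall us : R, h n <= us <= 1 - h n ->
     `| Num.sqrt (n%:R * h n)
          * (That M p K phi psi dpsi b n (h n) t us - Tcf M p Q q phi psi us)
          / qhat K b n (h n) t us
        - (- (phi us * Afun M p us * Gnh P K F b n (h n) t us)) |
     <= C * rate n (h n)}.
Proof.
have [L K_lip] := hKlip.
have kerK : lipschitz_kernel K L by split.
have unifU := uniform_sample_cdf hbmeas hF hFQ hind.
have C1Q : C1_on 0 1 Q q by split.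
have C1q : C1_on 0 1 q q2 by split.
have C1psi : C1_on 0 1 psi dpsi by split.
have [C [eps [Hmin [eps0 expansion]]]] := studentized_rate unifU
  (quantile_homo hbmeas hF hFQ) C1Q C1q hqpos hA1' hphic C1psi kerK.
apply: filterS (filterI (ae_regular_sample unifU) (filterI (ae_uniform_itv01 unifU)
  (ae_quantile_cdf hbmeas hF hFQ hQc))) => t [regular [U01 QU]].
exists C; near=> n => u hu; apply: expansion => //.
- by split=> //; near: n; [exact: log_large_eventually|exact: regular].
- have h_small : h n <= eps / 2.
    by near: n; apply: (cvgr_le (0 : R)) => //; rewrite divr_gt0.
  have radius_small : quantile_radius n <= eps / 2.
    by near: n; apply: quantile_radius_eventually_le; rewrite divr_gt0.
  by lra.
- by near: n; move/cvgryPge: hnh; exact.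
Unshelve. all: by end_near. Qed.
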